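(* For every abelian group $G$ and every $n>2$, the group $H^n(\mathbb RP^2,G)$ is trivial.
   Context: We work in Homotopy Type Theory (as in the HoTT Book). The real projective plane $\mathbb RP^2$ is the higher inductive type generated by a point $\star$, a path $\ell:\star=\star$ and a path $\mathsf{sq}:\ell^{-1}=\ell$. $\Sigma A$ is the suspension, with constructors $\mathsf{north},\mathsf{south}$ and $\mathsf{merid}\,a:\mathsf{north}=\mathsf{south}$ for $a:A$. $\|A\|_n$ is the $n$-truncation, with canonical elements $|a|$. Eilenberg-MacLane spaces. For an abelian group $G$, $\widetilde K(G,1)$ is the higher inductive type generated by a point $\star$, a path $\mathsf{loop}_k\,g:\star=\star$ for every $g:G$, and for all $g_1,g_2:G$ a filler witnessing $\mathsf{loop}_k\,g_1\cdot\mathsf{loop}_k\,g_2=\mathsf{loop}_k(g_1+g_2)$. For $n>1$, $\widetilde K(G,n):=\Sigma\,\widetilde K(G,n-1)$. The basepoint $0_k$ of $\widetilde K(G,n)$ is $\star$ if $n=1$ and $\mathsf{north}$ if $n>1$. $K(G,0):=G$ with basepoint $0_G$, and $K(G,n):=\|\widetilde K(G,n)\|_n$ with basepoint $|0_k|$ for $n\ge1$; all basepoints are written $0_k$. Addition. For $n\ge2$, $+_k:K(G,n)\times K(G,n)\to K(G,n)$ is the unique map with $x+_k0_k:=x$ and $0_k+_ky:=y$, these agreeing by $\mathsf{refl}$ at $(0_k,0_k)$. Cohomology. $H^n(X,G):=\|X\to K(G,n)\|_0$, an abelian group under pointwise $+_k$. *)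

(* Defs.v *)
From Stdlib Require Import List Arith.
Import ListNotations.

(** * Book homotopy type theory, as a formal system

    Univalence for Rocq's own universes is refuted by axioms that Rocq users
    take for granted (proof irrelevance gives uniqueness of identity proofs),
    so that a statement about Rocq types assuming it would be vacuous.  The
    theory is therefore represented as an object: de Bruijn terms, judgmental
    equality and the typing judgment [has Gamma t A].  A theorem of homotopy
    type theory is a closed type that has a closed inhabitant.

    The system has a cumulative hierarchy of Russell universes [Univ i],
    [Pi]-types with beta and eta, and constants for everything else.  As usual
    in the informal theory the constants carry no universe levels: a constant
    has one type for each choice of levels ([ty]).  The only exception is
    univalence, which is a different axiom for each universe. *)

Inductive cst : Set :=
| Empty | EmptyInd
| Unit | TT | UnitInd
| Sum | InL | InR | SumInd
| Nat | Zero | Succ | NatInd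
| Sigma | Pair | SigmaInd
| Id | Refl | J
| FunExt
| Univalence (i : nat)
| RP2 | RP2pt | RP2ell | RP2sq | RP2Ind | RP2Ind_ell | RP2Ind_sq
| Susp | North | South | Merid | SuspInd | SuspInd_merid
| KG1 | KG1pt | KG1loop | KG1fill | KG1Ind | KG1Ind_loop | KG1Ind_fill
| Trunc | Tr | Tr_trunc | TruncInd.

Inductive tm : Set :=
| Var (x : nat)
| Univ (i : nat)
| Pi (A B : tm)
| Lam (A b : tm)
| App (f a : tm)
| Cst (c : cst).

Fixpoint lift (k : nat) (t : tm) : tm :=
  match t with
  | Var x => Var (if k <=? x then S x else x)
  | Univ i => Univ i
  | Pi A B => Pi (lift k A) (lift (S k) B)
  | Lam A b => Lam (lift k A) (lift (S k) b)
  | App f a => App (lift k f) (lift k a)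
  | Cst c => Cst c
  end.

Fixpoint subst (u : tm) (k : nat) (t : tm) : tm :=
  match t with
  | Var x => match x ?= k with Lt => Var x | Eq => u | Gt => Var (pred x) end
  | Univ i => Univ i
  | Pi A B => Pi (subst u k A) (subst (lift 0 u) (S k) B)
  | Lam A b => Lam (subst u k A) (subst (lift 0 u) (S k) b)
  | App f a => App (subst u k f) (subst u k a)
  | Cst c => Cst c
  end.

Definition apps (c : cst) (l : list tm) : tm := fold_left App l (Cst c).

(** Judgmental equality: the congruence generated by beta, eta and the
    computation rules of the eliminators.  Only point constructors compute
    judgmentally; path constructors have constants for their computation
    rules.  The parameters repeated by a constructor are primed: on well-typed
    terms they agree with those of the eliminator. *)
Inductive conv : tm -> tm -> Prop :=
| conv_refl t : conv t t
| conv_sym t u : conv t u -> conv u t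
| conv_trans t u v : conv t u -> conv u v -> conv t v
| conv_Pi A A' B B' : conv A A' -> conv B B' -> conv (Pi A B) (Pi A' B')
| conv_Lam A A' b b' : conv A A' -> conv b b' -> conv (Lam A b) (Lam A' b')
| conv_App f f' a a' : conv f f' -> conv a a' -> conv (App f a) (App f' a')
| conv_beta A b a : conv (App (Lam A b) a) (subst a 0 b)
| conv_eta A f : conv (Lam A (App (lift 0 f) (Var 0))) f
| conv_Unit P p :
    conv (apps UnitInd [P; p; Cst TT]) p
| conv_InL A B P f g A' B' a :
    conv (apps SumInd [A; B; P; f; g; apps InL [A'; B'; a]]) (App f a)
| conv_InR A B P f g A' B' b :
    conv (apps SumInd [A; B; P; f; g; apps InR [A'; B'; b]]) (App g b)
| conv_Zero P z s :
    conv (apps NatInd [P; z; s; Cst Zero]) z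
| conv_Succ P z s n :
    conv (apps NatInd [P; z; s; App (Cst Succ) n])
         (App (App s n) (apps NatInd [P; z; s; n]))
| conv_Pair A B P f A' B' a b :
    conv (apps SigmaInd [A; B; P; f; apps Pair [A'; B'; a; b]])
         (App (App f a) b)
| conv_J A a P p x A' a' :
    conv (apps J [A; a; P; p; x; apps Refl [A'; a']]) p
| conv_RP2pt P b l s :
    conv (apps RP2Ind [P; b; l; s; Cst RP2pt]) b
| conv_North A P n s m A' :
    conv (apps SuspInd [A; P; n; s; m; apps North [A']]) n
| conv_South A P n s m A' :
    conv (apps SuspInd [A; P; n; s; m; apps South [A']]) s
| conv_KG1pt G q P b l s G' q' :
    conv (apps KG1Ind [G; q; P; b; l; s; apps KG1pt [G'; q']]) b
| conv_Tr n A P h f n' A' a :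
    conv (apps TruncInd [n; A; P; h; f; apps Tr [n'; A'; a]]) (App f a).

(** ** Named binders

    A [form] is a term with as many free variables as its argument says.
    Binders are Rocq functions; a variable is stored by its level and becomes
    a de Bruijn index at the depth where it is used. *)
Definition form : Type := nat -> tm.

Definition bound (d : nat) : form := fun d' => Var (d' - S d).
Definition univ (i : nat) : form := fun _ => Univ i.
Definition cc (c : cst) : form := fun _ => Cst c.
Definition app (f a : form) : form := fun d => App (f d) (a d).
Definition pi (A : form) (B : form -> form) : form :=
  fun d => Pi (A d) (B (bound d) (S d)).
Definition lam (A : form) (b : form -> form) : form :=
  fun d => Lam (A d) (b (bound d) (S d)).
Definition closed (a : form) : tm := a 0.

Declare Scope form_scope.
Delimit Scope form_scope with form.
Bind Scope form_scope with form.
Local Open Scope form_scope.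

Notation "'Π' x : A , B" := (pi A (fun x => B))
  (at level 200, x name, A at level 99, B at level 200) : form_scope.
Notation "'λ' x : A , b" := (lam A (fun x => b))
  (at level 200, x name, A at level 99, b at level 200) : form_scope.
Notation "A ⇒ B" := (pi A (fun _ => B))
  (at level 99, right associativity) : form_scope.
Notation "f ⋅ a" := (app f a) (at level 11, left associativity) : form_scope.

(** ** Basic types *)

Definition sg (A : form) (B : form -> form) : form := cc Sigma ⋅ A ⋅ (lam A B).
Notation "'Σ' x : A , B" := (sg A (fun x => B))
  (at level 200, x name, A at level 99, B at level 200) : form_scope.
Notation "A × B" := (sg A (fun _ => B))
  (at level 39, right associativity) : form_scope.

Definition mkpair (A : form) (B : form -> form) (a b : form) : form :=
  cc Pair ⋅ A ⋅ (lam A B) ⋅ a ⋅ b.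
Definition pr1 (A : form) (B : form -> form) (p : form) : form :=
  cc SigmaInd ⋅ A ⋅ (lam A B) ⋅ (λ _ : sg A B, A) ⋅ (λ a : A, λ _ : B a, a) ⋅ p.

Definition nat_ : form := cc Nat.
Definition succ (n : form) : form := cc Succ ⋅ n.
Fixpoint num (n : nat) : form :=
  match n with 0 => cc Zero | S m => succ (num m) end.
Definition nat_ind (P : form -> form) (z : form) (s : form -> form -> form)
    (n : form) : form :=
  cc NatInd ⋅ (lam nat_ P) ⋅ z ⋅ (λ m : nat_, λ r : P m, s m r) ⋅ n.
Definition nat_add (m n : form) : form :=
  nat_ind (fun _ => nat_) n (fun _ r => succ r) m.
Definition nat_lt (m n : form) : form :=
  Σ k : nat_, cc Id ⋅ nat_ ⋅ (nat_add m (succ k)) ⋅ n.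

(** ** Paths *)

Definition idt (A x y : form) : form := cc Id ⋅ A ⋅ x ⋅ y.
Definition refl (A x : form) : form := cc Refl ⋅ A ⋅ x.
Definition ind (A a : form) (P : form -> form -> form) (c x p : form) : form :=
  cc J ⋅ A ⋅ a ⋅ (λ y : A, λ q : idt A a y, P y q) ⋅ c ⋅ x ⋅ p.

Definition inv (A x y p : form) : form :=
  ind A x (fun z _ => idt A z x) (refl A x) y p.
Definition cat (A x y z p q : form) : form :=
  ind A y (fun w _ => idt A x w) p z q.
Definition ap (A B : form) (f : form -> form) (x y p : form) : form :=
  ind A x (fun z _ => idt B (f x) (f z)) (refl B (f x)) y p.
Definition tp (A : form) (P : form -> form) (x y p u : form) : form :=
  ind A x (fun z _ => P z) u y p.

(** [pathOver A P x y p u v] is the type of paths from [u : P x] to [v : P y]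
    lying over [p : x = y]. *)
Definition pathOver (A : form) (P : form -> form) (x y p u v : form) : form :=
  idt (P y) (tp A P x y p u) v.
Definition apd (A : form) (P : form -> form) (f : form -> form) (x y p : form) :
    form :=
  ind A x (fun z q => pathOver A P x z q (f x) (f z)) (refl (P x) (f x)) y p.
Definition invOver (A : form) (P : form -> form) (x y p u v r : form) : form :=
  ind A x
    (fun z q =>
       Π w : P z, pathOver A P x z q u w ⇒ pathOver A P z x (inv A x z q) w u)
    (λ w : P x, λ s : idt (P x) u w, inv (P x) u w s) y p ⋅ v ⋅ r.
Definition catOver (A : form) (P : form -> form) (x y z p q u v w r s : form) :
    form :=
  ind A y
    (fun z' q' =>
       Π w' : P z', pathOver A P y z' q' v w' ⇒
                    pathOver A P x z' (cat A x y z' p q') u w')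
    (λ w' : P y, λ t : idt (P y) v w', cat (P y) (tp A P x y p u) v w' r t)
    z q ⋅ w ⋅ s.

(** Functoriality of [apd]; both hold by [refl] at a reflexivity path. *)
Definition apd_inv (A : form) (P : form -> form) (f : form -> form)
    (x y p : form) : form :=
  ind A x
    (fun z q =>
       idt (pathOver A P z x (inv A x z q) (f z) (f x))
           (apd A P f z x (inv A x z q))
           (invOver A P x z q (f x) (f z) (apd A P f x z q)))
    (refl (idt (P x) (f x) (f x)) (refl (P x) (f x))) y p.
Definition apd_cat (A : form) (P : form -> form) (f : form -> form)
    (x y z p q : form) : form :=
  ind A y
    (fun w r =>
       idt (pathOver A P x w (cat A x y w p r) (f x) (f w))
           (apd A P f x w (cat A x y w p r))
           (catOver A P x y w p r (f x) (f y) (f w)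
              (apd A P f x y p) (apd A P f y w r)))
    (refl (pathOver A P x y p (f x) (f y)) (apd A P f x y p)) z q.

(** ** Equivalences and truncation levels *)

Definition isEquiv (A B f : form) : form :=
  (Σ g : B ⇒ A, Π y : B, idt B (f ⋅ (g ⋅ y)) y) ×
  (Σ h : B ⇒ A, Π x : A, idt A (h ⋅ (f ⋅ x)) x).
Definition equiv (A B : form) : form := Σ f : A ⇒ B, isEquiv A B f.
Definition idEquiv (A : form) : form :=
  let half := mkpair (A ⇒ A) (fun g => Π x : A, idt A (g ⋅ x) x)
                (λ x : A, x) (λ x : A, refl A x) in
  mkpair (A ⇒ A) (isEquiv A A) (λ x : A, x)
    (mkpair (Σ g : A ⇒ A, Π x : A, idt A (g ⋅ x) x)
          (fun _ => Σ h : A ⇒ A, Π x : A, idt A (h ⋅ x) x) half half).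

Definition isContr (A : form) : form := Σ a : A, Π x : A, idt A a x.
Definition isSet (A : form) : form :=
  Π x : A, Π y : A, Π p : idt A x y, Π q : idt A x y, idt (idt A x y) p q.

(** Truncation levels are shifted by two: [isTrunc i n A] says that
    [A : Univ i] is an (n-2)-type, and [Trunc ⋅ n ⋅ A] is the
    (n-2)-truncation. *)
Definition isTrunc (i : nat) (n A : form) : form :=
  nat_ind (fun _ => univ i ⇒ univ i)
    (λ X : univ i, isContr X)
    (fun _ r => λ X : univ i, Π x : X, Π y : X, r ⋅ (idt X x y)) n ⋅ A.

(** ** Abelian groups *)

Definition abLaws (G z p neg : form) : form :=
  (Π x : G, Π y : G, Π w : G,
     idt G (p ⋅ (p ⋅ x ⋅ y) ⋅ w) (p ⋅ x ⋅ (p ⋅ y ⋅ w))) ×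
  (Π x : G, Π y : G, idt G (p ⋅ x ⋅ y) (p ⋅ y ⋅ x)) ×
  (Π x : G, idt G (p ⋅ x ⋅ z) x) ×
  (Π x : G, idt G (p ⋅ x ⋅ (neg ⋅ x)) z).

Record grp := Grp { carrier : form; zero : form; plus : form }.

(** [T G], for every abelian group [G] with carrier in [Univ i]. *)
Definition forall_AbGrp (i : nat) (T : grp -> form) : form :=
  Π G : univ i, isSet G ⇒ Π z : G, Π p : G ⇒ G ⇒ G, Π neg : G ⇒ G,
  abLaws G z p neg ⇒ T (Grp G z p).

(** ** Types of the constants *)

Definition rp2 : form := cc RP2.
Definition rp2pt : form := cc RP2pt.
Definition rp2ell : form := cc RP2ell.
Definition rp2loops : form := idt rp2 rp2pt rp2pt.
Definition rp2inv : form := inv rp2 rp2pt rp2pt rp2ell.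
Definition rp2over (P : form -> form) (b q : form) : form :=
  pathOver rp2 P rp2pt rp2pt q b b.
Definition rp2tpsq (P : form -> form) (b r : form) : form :=
  tp rp2loops (rp2over P b) rp2inv rp2ell (cc RP2sq) r.
(** The datum over [sq] in the induction principle, given the data [b] and [l]
    over the point and over the loop. *)
Definition rp2sqOver (P : form -> form) (b l : form) : form :=
  idt (rp2over P b rp2ell)
    (rp2tpsq P b (invOver rp2 P rp2pt rp2pt rp2ell b b l)) l.

Definition rp2ctx (j : nat) (T : form -> form -> form -> form -> form) : form :=
  Π P : rp2 ⇒ univ j, Π b : P ⋅ rp2pt, Π l : rp2over (app P) b rp2ell,
  Π s : rp2sqOver (app P) b l, T P b l s.
Definition rp2ind (P b l s x : form) : form := cc RP2Ind ⋅ P ⋅ b ⋅ l ⋅ s ⋅ x.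

(** The path [f(sq)] relates [apd f ℓ⁻¹] and [apd f ℓ]; the computation rule
    compares it with [s] after rewriting [apd f ℓ] to [l]. *)
Definition rp2_beta_sq (P b l s : form) : form :=
  let f := rp2ind P b l s in
  let D := rp2over (app P) b in
  let T := rp2tpsq (app P) b in
  let iv := invOver rp2 (app P) rp2pt rp2pt rp2ell b b in
  let fl := apd rp2 (app P) f rp2pt rp2pt rp2ell in
  let fli := apd rp2 (app P) f rp2pt rp2pt rp2inv in
  let beta := cc RP2Ind_ell ⋅ P ⋅ b ⋅ l ⋅ s in
  let fsq := apd rp2loops D (apd rp2 (app P) f rp2pt rp2pt)
               rp2inv rp2ell (cc RP2sq) in
  let toinv := ap (D rp2inv) (D rp2ell) T fli (iv fl)
                 (apd_inv rp2 (app P) f rp2pt rp2pt rp2ell) in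
  let tol := ap (D rp2ell) (D rp2ell) (fun r => T (iv r)) fl l beta in
  idt (rp2sqOver (app P) b l)
    (cat (D rp2ell) (T (iv l)) (T (iv fl)) l
       (inv (D rp2ell) (T (iv fl)) (T (iv l)) tol)
       (cat (D rp2ell) (T (iv fl)) (T fli) l
          (inv (D rp2ell) (T fli) (T (iv fl)) toinv)
          (cat (D rp2ell) (T fli) fl l fsq beta)))
    s.

Definition susp (A : form) : form := cc Susp ⋅ A.
Definition north (A : form) : form := cc North ⋅ A.
Definition south (A : form) : form := cc South ⋅ A.
Definition merid (A a : form) : form := cc Merid ⋅ A ⋅ a.
Definition suspctx (i j : nat)
    (T : form -> form -> form -> form -> form -> form) : form :=
  Π A : univ i, Π P : susp A ⇒ univ j,
  Π n : P ⋅ (north A), Π s : P ⋅ (south A),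
  Π m : (Π a : A,
           pathOver (susp A) (app P) (north A) (south A) (merid A a) n s),
  T A P n s m.

(** The type depends on the group only through its carrier [G] and its addition
    [p]. *)
Definition kg1 (G p : form) : form := cc KG1 ⋅ G ⋅ p.
Definition kpt (G p : form) : form := cc KG1pt ⋅ G ⋅ p.
Definition kloop (G p g : form) : form := cc KG1loop ⋅ G ⋅ p ⋅ g.
Definition kfill (G p g h : form) : form := cc KG1fill ⋅ G ⋅ p ⋅ g ⋅ h.
Definition kloops (G p : form) : form := idt (kg1 G p) (kpt G p) (kpt G p).
Definition kcat (G p g h : form) : form :=
  cat (kg1 G p) (kpt G p) (kpt G p) (kpt G p) (kloop G p g) (kloop G p h).
Definition kover (G p : form) (P : form -> form) (b q : form) : form :=
  pathOver (kg1 G p) P (kpt G p) (kpt G p) q b b.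
Definition kcatOver (G p : form) (P : form -> form) (b g h r s : form) : form :=
  catOver (kg1 G p) P (kpt G p) (kpt G p) (kpt G p)
    (kloop G p g) (kloop G p h) b b b r s.
Definition ktpfill (G p : form) (P : form -> form) (b g h r : form) : form :=
  tp (kloops G p) (kover G p P b) (kcat G p g h) (kloop G p (p ⋅ g ⋅ h))
    (kfill G p g h) r.
Definition kfillOver (G p : form) (P : form -> form) (b l g h : form) : form :=
  idt (kover G p P b (kloop G p (p ⋅ g ⋅ h)))
    (ktpfill G p P b g h (kcatOver G p P b g h (l ⋅ g) (l ⋅ h)))
    (l ⋅ (p ⋅ g ⋅ h)).

Definition kctx (i j : nat)
    (T : form -> form -> form -> form -> form -> form -> form) : form :=
  Π G : univ i, Π p : G ⇒ G ⇒ G, Π P : kg1 G p ⇒ univ j, Π b : P ⋅ (kpt G p),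
  Π l : (Π g : G, kover G p (app P) b (kloop G p g)),
  Π s : (Π g : G, Π h : G,
           kfillOver G p (app P) b l g h),
  T G p P b l s.
Definition kind (G p P b l s x : form) : form :=
  cc KG1Ind ⋅ G ⋅ p ⋅ P ⋅ b ⋅ l ⋅ s ⋅ x.

(** As for [rp2_beta_sq], with three uses of the computation rule on loops. *)
Definition k_beta_fill (G p P b l s g h : form) : form :=
  let f := kind G p P b l s in
  let D := kover G p (app P) b in
  let T := ktpfill G p (app P) b g h in
  let gh := p ⋅ g ⋅ h in
  let E := D (kloop G p gh) in
  let ct := kcatOver G p (app P) b g h in
  let fl := fun q => apd (kg1 G p) (app P) f (kpt G p) (kpt G p) q in
  let beta := fun a => cc KG1Ind_loop ⋅ G ⋅ p ⋅ P ⋅ b ⋅ l ⋅ s ⋅ a in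
  let fg := fl (kloop G p g) in
  let fh := fl (kloop G p h) in
  let fc := fl (kcat G p g h) in
  let fgh := fl (kloop G p gh) in
  let ffill := apd (kloops G p) D fl (kcat G p g h) (kloop G p gh)
                 (kfill G p g h) in
  let tocat := ap (D (kcat G p g h)) E T fc (ct fg fh)
                 (apd_cat (kg1 G p) (app P) f (kpt G p) (kpt G p) (kpt G p)
                    (kloop G p g) (kloop G p h)) in
  let tog := ap (D (kloop G p g)) E (fun r => T (ct r fh)) fg (l ⋅ g) (beta g) in
  let toh := ap (D (kloop G p h)) E (fun r => T (ct (l ⋅ g) r)) fh (l ⋅ h)
               (beta h) in
  let T0 := T (ct (l ⋅ g) (l ⋅ h)) in
  let T1 := T (ct (l ⋅ g) fh) in
  let T2 := T (ct fg fh) in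
  let T3 := T fc in
  idt (kfillOver G p (app P) b l g h)
    (cat E T0 T1 (l ⋅ gh) (inv E T1 T0 toh)
       (cat E T1 T2 (l ⋅ gh) (inv E T2 T1 tog)
          (cat E T2 T3 (l ⋅ gh) (inv E T3 T2 tocat)
             (cat E T3 fgh (l ⋅ gh) ffill (beta gh)))))
    (s ⋅ g ⋅ h).

Definition trunc (n A : form) : form := cc Trunc ⋅ n ⋅ A.
Definition tr (n A a : form) : form := cc Tr ⋅ n ⋅ A ⋅ a.

(** [i] is the level of the parameters, [j] the level of the motive. *)
Definition ty_form (i j : nat) (c : cst) : form :=
  match c with
  | Empty => univ 0
  | EmptyInd => Π P : cc Empty ⇒ univ j, Π x : cc Empty, P ⋅ x
  | Unit => univ 0
  | TT => cc Unit
  | UnitInd => Π P : cc Unit ⇒ univ j, P ⋅ cc TT ⇒ Π x : cc Unit, P ⋅ x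
  | Sum => univ i ⇒ univ i ⇒ univ i
  | InL => Π A : univ i, Π B : univ i, A ⇒ cc Sum ⋅ A ⋅ B
  | InR => Π A : univ i, Π B : univ i, B ⇒ cc Sum ⋅ A ⋅ B
  | SumInd =>
      Π A : univ i, Π B : univ i, Π P : cc Sum ⋅ A ⋅ B ⇒ univ j,
      (Π a : A, P ⋅ (cc InL ⋅ A ⋅ B ⋅ a)) ⇒
      (Π b : B, P ⋅ (cc InR ⋅ A ⋅ B ⋅ b)) ⇒
      Π x : cc Sum ⋅ A ⋅ B, P ⋅ x
  | Nat => univ 0
  | Zero => nat_
  | Succ => nat_ ⇒ nat_
  | NatInd =>
      Π P : nat_ ⇒ univ j, P ⋅ (num 0) ⇒
      (Π n : nat_, P ⋅ n ⇒ P ⋅ (succ n)) ⇒ Π n : nat_, P ⋅ n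
  | Sigma => Π A : univ i, (A ⇒ univ i) ⇒ univ i
  | Pair =>
      Π A : univ i, Π B : A ⇒ univ i, Π a : A, B ⋅ a ⇒ cc Sigma ⋅ A ⋅ B
  | SigmaInd =>
      Π A : univ i, Π B : A ⇒ univ i, Π P : cc Sigma ⋅ A ⋅ B ⇒ univ j,
      (Π a : A, Π b : B ⋅ a, P ⋅ (cc Pair ⋅ A ⋅ B ⋅ a ⋅ b)) ⇒
      Π x : cc Sigma ⋅ A ⋅ B, P ⋅ x
  | Id => Π A : univ i, A ⇒ A ⇒ univ i
  | Refl => Π A : univ i, Π a : A, idt A a a
  | J =>
      Π A : univ i, Π a : A, Π P : (Π x : A, idt A a x ⇒ univ j),
      P ⋅ a ⋅ (refl A a) ⇒ Π x : A, Π p : idt A a x, P ⋅ x ⋅ p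
  | FunExt =>
      Π A : univ i, Π B : A ⇒ univ i,
      Π f : (Π x : A, B ⋅ x), Π g : (Π x : A, B ⋅ x),
      isEquiv (idt (Π x : A, B ⋅ x) f g) (Π x : A, idt (B ⋅ x) (f ⋅ x) (g ⋅ x))
        (λ p : idt (Π x : A, B ⋅ x) f g,
           ind (Π x : A, B ⋅ x) f
             (fun h _ => Π x : A, idt (B ⋅ x) (f ⋅ x) (h ⋅ x))
             (λ x : A, refl (B ⋅ x) (f ⋅ x)) g p)
  | Univalence k =>
      Π A : univ k, Π B : univ k,
      isEquiv (idt (univ k) A B) (equiv A B)
        (λ p : idt (univ k) A B,
           ind (univ k) A (fun X _ => equiv A X) (idEquiv A) B p)
  | RP2 => univ 0
  | RP2pt => rp2
  | RP2ell => rp2loops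
  | RP2sq => idt rp2loops rp2inv rp2ell
  | RP2Ind => rp2ctx j (fun P _ _ _ => Π x : rp2, P ⋅ x)
  | RP2Ind_ell =>
      rp2ctx j (fun P b l s =>
        idt (rp2over (app P) b rp2ell)
          (apd rp2 (app P) (rp2ind P b l s) rp2pt rp2pt rp2ell) l)
  | RP2Ind_sq => rp2ctx j rp2_beta_sq
  | Susp => univ i ⇒ univ i
  | North => Π A : univ i, susp A
  | South => Π A : univ i, susp A
  | Merid => Π A : univ i, A ⇒ idt (susp A) (north A) (south A)
  | SuspInd => suspctx i j (fun A P _ _ _ => Π x : susp A, P ⋅ x)
  | SuspInd_merid =>
      suspctx i j (fun A P n s m => Π a : A,
        idt (pathOver (susp A) (app P) (north A) (south A) (merid A a) n s)
          (apd (susp A) (app P) (app (cc SuspInd ⋅ A ⋅ P ⋅ n ⋅ s ⋅ m))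
             (north A) (south A) (merid A a))
          (m ⋅ a))
  | KG1 => Π G : univ i, (G ⇒ G ⇒ G) ⇒ univ i
  | KG1pt => Π G : univ i, Π p : G ⇒ G ⇒ G, kg1 G p
  | KG1loop => Π G : univ i, Π p : G ⇒ G ⇒ G, G ⇒ kloops G p
  | KG1fill =>
      Π G : univ i, Π p : G ⇒ G ⇒ G, Π g : G, Π h : G,
      idt (kloops G p) (kcat G p g h) (kloop G p (p ⋅ g ⋅ h))
  | KG1Ind => kctx i j (fun G p P _ _ _ => Π x : kg1 G p, P ⋅ x)
  | KG1Ind_loop =>
      kctx i j (fun G p P b l s => Π g : G,
        idt (kover G p (app P) b (kloop G p g))
          (apd (kg1 G p) (app P) (kind G p P b l s)
             (kpt G p) (kpt G p) (kloop G p g))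
          (l ⋅ g))
  | KG1Ind_fill =>
      kctx i j (fun G p P b l s => Π g : G, Π h : G,
        k_beta_fill G p P b l s g h)
  | Trunc => nat_ ⇒ univ i ⇒ univ i
  | Tr => Π n : nat_, Π A : univ i, A ⇒ trunc n A
  | Tr_trunc => Π n : nat_, Π A : univ i, isTrunc i n (trunc n A)
  | TruncInd =>
      Π n : nat_, Π A : univ i, Π P : trunc n A ⇒ univ j,
      (Π x : trunc n A, isTrunc j n (P ⋅ x)) ⇒
      (Π a : A, P ⋅ (tr n A a)) ⇒ Π x : trunc n A, P ⋅ x
  end.

Definition ty (i j : nat) (c : cst) : tm := closed (ty_form i j c).

(** ** The typing judgment

    Contexts need no separate well-formedness judgment: starting from the empty
    context, [has_Pi] and [has_Lam] only add types to them. *)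
Inductive has : list tm -> tm -> tm -> Prop :=
| has_Var Gamma x A :
    nth_error Gamma x = Some A ->
    has Gamma (Var x) (Nat.iter (S x) (lift 0) A)
| has_Univ Gamma i : has Gamma (Univ i) (Univ (S i))
| has_Pi Gamma A B i :
    has Gamma A (Univ i) -> has (A :: Gamma) B (Univ i) ->
    has Gamma (Pi A B) (Univ i)
| has_Lam Gamma A b B i :
    has Gamma A (Univ i) -> has (A :: Gamma) b B ->
    has Gamma (Lam A b) (Pi A B)
| has_App Gamma f a A B :
    has Gamma f (Pi A B) -> has Gamma a A ->
    has Gamma (App f a) (subst a 0 B)
| has_Cst Gamma c i j : has Gamma (Cst c) (ty i j c)
| has_cumul Gamma A i : has Gamma A (Univ i) -> has Gamma A (Univ (S i))
| has_conv Gamma t A B i :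
    has Gamma t A -> has Gamma B (Univ i) -> conv A B -> has Gamma t B.

Definition HoTT_proves (A : form) : Prop := exists t : tm, has [] t (closed A).

(** ** Eilenberg-MacLane spaces and cohomology *)

(** [Ktilde i G m] is the untruncated space of index [m + 1]. *)
Definition Ktilde (i : nat) (G : grp) (m : form) : form :=
  nat_ind (fun _ => univ i) (kg1 (carrier G) (plus G)) (fun _ X => susp X) m.
Definition Ktilde_pt (i : nat) (G : grp) (m : form) : form :=
  nat_ind (fun k => Ktilde i G k) (kpt (carrier G) (plus G)) (fun k _ => north (Ktilde i G k)) m.

Definition K (i : nat) (G : grp) (n : form) : form :=
  nat_ind (fun _ => univ i) (carrier G)
    (fun m _ => trunc (succ (succ (succ m))) (Ktilde i G m)) n.
Definition K_pt (i : nat) (G : grp) (n : form) : form :=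
  nat_ind (fun k => K i G k) (zero G)
    (fun m _ => tr (succ (succ (succ m))) (Ktilde i G m) (Ktilde_pt i G m)) n.

(** The additions on [K(G,n)], with the data that makes them unique when
    [n >= 2]: the two unit laws, agreeing at the base point. *)
Definition unitR (i : nat) (G : grp) (n m : form) : form :=
  Π x : K i G n, idt (K i G n) (m ⋅ x ⋅ (K_pt i G n)) x.
Definition unitL (i : nat) (G : grp) (n m : form) : form :=
  Π y : K i G n, idt (K i G n) (m ⋅ (K_pt i G n) ⋅ y) y.
Definition unitsAgree (i : nat) (G : grp) (n m : form) : form :=
  Σ r : unitR i G n m, Σ l : unitL i G n m,
  idt (idt (K i G n) (m ⋅ (K_pt i G n) ⋅ (K_pt i G n)) (K_pt i G n))
    (r ⋅ (K_pt i G n)) (l ⋅ (K_pt i G n)).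
Definition KAddition (i : nat) (G : grp) (n : form) : form :=
  Σ m : K i G n ⇒ K i G n ⇒ K i G n, unitsAgree i G n m.
Definition Kplus (i : nat) (G : grp) (n add : form) : form :=
  pr1 (K i G n ⇒ K i G n ⇒ K i G n) (unitsAgree i G n) add.

Definition H (i : nat) (X : form) (G : grp) (n : form) : form := trunc (num 2) (X ⇒ K i G n).

(** Pointwise addition of cohomology classes. *)
Definition Hplus (i : nat) (X : form) (G : grp)
    (n add : form) : form :=
  let M := X ⇒ K i G n in
  let rec := fun (f : form -> form) (x : form) =>
    cc TruncInd ⋅ (num 2) ⋅ M ⋅ (λ _ : H i X G n, H i X G n)
      ⋅ (λ _ : H i X G n, cc Tr_trunc ⋅ (num 2) ⋅ M) ⋅ (lam M f) ⋅ x in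
  λ x : H i X G n, λ y : H i X G n,
    rec (fun f => rec (fun g =>
      tr (num 2) M (λ a : X, Kplus i G n add ⋅ (f ⋅ a) ⋅ (g ⋅ a))) y) x.

(** Isomorphism of a group [A], with operation [p], with the trivial
    group. *)
Definition isoTrivial (A p : form) : form :=
  Σ f : A ⇒ cc Unit,
    isEquiv A (cc Unit) f ×
    (Π x : A, Π y : A,
       idt (cc Unit) (f ⋅ (p ⋅ x ⋅ y))
         ((λ _ : cc Unit, λ _ : cc Unit, cc TT) ⋅ (f ⋅ x) ⋅ (f ⋅ y))).

(* Main.v *)
From Stdlib Require Import List Arith.
Import ListNotations.
Require Import Defs.

(** For [n > 2] the space [K(G,n)] is 2-connected,
    whereas RP2 is built from one point, one loop and one 2-cell.  Let
    [f : RP2 -> K(G,n)]; the proposition [Q] stating that [f] and the constant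
    map are equal in the set [H^n(RP2,G)] follows, by function extensionality,
    from a section of [x |-> (0 = f x)].  Induction on RP2 asks for a point of
    this family over the base point, a path between two of its points and a path
    between two of its paths.  As [Q] is a proposition, each of the three may be
    chosen by connectedness ([rp2_section]), and no path algebra is needed.

    Connectedness is used in the form of an induction principle [Conn]: a family
    of truncated types over a pointed type has a section through each point of
    the fibre over the base point.  Suspension improves it by one level
    ([conn_susp]), starting from [K~(G,1)], over which families of propositions
    have sections ([conn_em]); truncation preserves it ([conn_trunc]).  Passing
    to the loop space costs one level ([conn_loop_proof]): a family of m-types over
    the loops at [y0] is a point of the fibre over [y0] of the family
    [y |-> ((y0 = y) -> m-Type)], which is one of (m+1)-types because of
    univalence ([trunc_hType_proof]); the section through this point is a family over
    all paths starting at [y0], to which path induction applies.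

    Derivations are obtained by computation.  A type checker [infer] is proved
    sound for the typing judgment and run on explicit terms.  It handles
    concrete universe levels only, which is enough: adding a constant to all
    levels preserves derivability ([raise_has]), so the theorem for groups in
    [Univ 0] yields all others.  Proved lemmas become variables of a context,
    eliminated by beta-redexes ([admissible_cons]); hence the types met later do
    not contain their proofs. *)

(** * A sound type checker *)

Scheme Equality for cst.
Scheme Equality for tm.

Definition unwind (t : tm) (l : list tm) : tm := fold_left App l t.

Fixpoint spine (t : tm) (l : list tm) : tm * list tm :=
  match t with App f a => spine f (a :: l) | _ => (t, l) end.

(** The judgmental computation rules, at the head of the application of [c] to
    the arguments [l]; [w] reduces the argument that is eliminated. *)
Definition iota (w : tm -> tm) (c : cst) (l : list tm) : option (tm * list tm) :=
  match c, l with
  | UnitInd, P :: p :: x :: l' =>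
      match w x with Cst TT => Some (p, l') | _ => None end
  | SumInd, A :: B :: P :: f :: g :: x :: l' =>
      match w x with
      | App (App (App (Cst InL) _) _) a => Some (f, a :: l')
      | App (App (App (Cst InR) _) _) b => Some (g, b :: l')
      | _ => None
      end
  | NatInd, P :: z :: s :: n :: l' =>
      match w n with
      | Cst Zero => Some (z, l')
      | App (Cst Succ) k => Some (s, k :: apps NatInd [P; z; s; k] :: l')
      | _ => None
      end
  | SigmaInd, A :: B :: P :: f :: x :: l' =>
      match w x with
      | App (App (App (App (Cst Pair) _) _) a) b => Some (f, a :: b :: l')
      | _ => None
      end
  | J, A :: a :: P :: p :: x :: q :: l' =>
      match w q with App (App (Cst Refl) _) _ => Some (p, l') | _ => None end
  | RP2Ind, P :: b :: k :: s :: x :: l' =>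
      match w x with Cst RP2pt => Some (b, l') | _ => None end
  | SuspInd, A :: P :: n :: s :: m :: x :: l' =>
      match w x with
      | App (Cst North) _ => Some (n, l')
      | App (Cst South) _ => Some (s, l')
      | _ => None
      end
  | KG1Ind, G :: q :: P :: b :: k :: s :: x :: l' =>
      match w x with App (App (Cst KG1pt) _) _ => Some (b, l') | _ => None end
  | TruncInd, n :: A :: P :: h :: f :: x :: l' =>
      match w x with
      | App (App (App (Cst Tr) _) _) a => Some (f, a :: l')
      | _ => None
      end
  | _, _ => None
  end.

(** [l] is the stack of arguments of [t].  Stopping early, for lack of fuel [n], is
    sound. *)
Fixpoint whnf (n : nat) (t : tm) (l : list tm) : tm :=
  match n with
  | 0 => unwind t l
  | S n =>
      match t with
      | App f a => whnf n f (a :: l)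
      | Lam A b =>
          match l with a :: l' => whnf n (subst a 0 b) l' | [] => t end
      | Cst c =>
          match iota (fun u => whnf n u []) c l with
          | Some (u, l') => whnf n u l'
          | None => unwind t l
          end
      | _ => unwind t l
      end
  end.

Lemma conv_unwind t u l : conv t u -> conv (unwind t l) (unwind u l).
Proof.
  revert t u; induction l as [|a l IH]; cbn; intros t u h; auto.
  apply IH, conv_App; auto using conv_refl.
Qed.

Lemma iota_sound w c l u l' :
  (forall t, conv t (w t)) -> iota w c l = Some (u, l') ->
  conv (unwind (Cst c) l) (unwind u l').
Proof.
  intros hw.
  assert (arg : forall x v f g m, w x = v -> conv (App f v) g ->
            conv (unwind (App f x) m) (unwind g m)).
  { intros x v f g m <- h; apply conv_unwind.
    eapply conv_trans; [apply conv_App; [apply conv_refl | apply hw] | exact h]. }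
  destruct c; cbn; try discriminate; intros e;
    repeat match type of e with
      | match ?x with _ => _ end = _ => destruct x eqn:?; try discriminate
      end;
    injection e as <- <-;
    match goal with
    | E : w ?x = ?v |- _ => cbn; eapply (arg x v _ _ _ E)
    end;
    solve [ apply conv_Unit | apply conv_InL | apply conv_InR | apply conv_Zero
          | apply conv_Succ | apply conv_Pair | apply conv_J | apply conv_RP2pt
          | apply conv_North | apply conv_South | apply conv_KG1pt
          | apply conv_Tr ].
Qed.

Lemma whnf_sound n : forall t l, conv (unwind t l) (whnf n t l).
Proof.
  induction n as [|n IH]; intros t l; cbn; [apply conv_refl|].
  destruct t; try apply conv_refl.
  - destruct l as [|a l]; [apply conv_refl|].
    eapply conv_trans; [|apply IH].
    apply (conv_unwind (App (Lam t1 t2) a) (subst a 0 t2) l), conv_beta.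
  - apply (IH t1 (t2 :: l)).
  - destruct (iota _ c l) as [[u l']|] eqn:e; [|apply conv_refl].
    eapply conv_trans; [eapply iota_sound; [|exact e] | apply IH].
    intros t; apply (IH t []).
Qed.

(** Conditionals are used instead of boolean operators, which would evaluate both
    operands. *)
Fixpoint eqv (n : nat) (t u : tm) : bool :=
  if tm_beq t u then true else
  match n with
  | 0 => false
  | S n =>
      match whnf n t [], whnf n u [] with
      | Univ i, Univ j => i =? j
      | Pi A B, Pi A' B' => if eqv n A A' then eqv n B B' else false
      | Lam _ b, Lam _ b' => eqv n b b'
      | Lam _ b, f => eqv n b (App (lift 0 f) (Var 0))
      | f, Lam _ b => eqv n (App (lift 0 f) (Var 0)) b
      | App f a, App g b => if eqv n f g then eqv n a b else false
      | Var x, Var y => x =? y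
      | Cst c, Cst d => cst_beq c d
      | _, _ => false
      end
  end.

Lemma subst_lift_var b : forall k, subst (Var k) k (lift (S k) b) = b.
Proof.
  induction b; intros k; cbn [lift subst]; f_equal; auto.
  - destruct (Nat.leb_spec (S k) x) as [h|h].
    + rewrite (proj2 (Nat.compare_gt_iff (S x) k)) by (apply Nat.lt_lt_succ_r, h).
      reflexivity.
    + destruct (Nat.compare_spec x k) as [->| |h']; auto.
      exfalso; apply (Nat.lt_irrefl x), (Nat.lt_le_trans _ _ _ h h').
Qed.

(** Beta and eta make the domain of an abstraction irrelevant to conversion. *)
Lemma conv_lam A A' b b' : conv b b' -> conv (Lam A b) (Lam A' b').
Proof.
  intros h; eapply conv_trans; [apply conv_sym, (conv_eta A')|]; cbn.
  apply conv_Lam; [apply conv_refl|].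
  eapply conv_trans; [apply conv_beta|].
  rewrite subst_lift_var; exact h.
Qed.

Lemma eqv_sound n : forall t u, eqv n t u = true -> conv t u.
Proof.
  induction n as [|n IH]; intros t u; cbn [eqv];
    destruct (tm_beq t u) eqn:et; intros e;
    try (apply internal_tm_dec_bl in et; subst; apply conv_refl); try discriminate.
  eapply conv_trans; [apply (whnf_sound n t [])|].
  eapply conv_trans; [|apply conv_sym, (whnf_sound n u [])].
  destruct (whnf n t []) as [x|i|A B|A b|f a|c] eqn:Et,
    (whnf n u []) as [y|j|A' B'|A' b'|g a'|c'] eqn:Eu; try discriminate;
    try apply Nat.eqb_eq in e;
    try (destruct (eqv n _ _) eqn:e1 in e; [|discriminate]).
  all: try solve [ subst; apply conv_refl
    | apply conv_Pi; auto
    | apply conv_App; auto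
    | apply conv_lam; auto
    | eapply conv_trans; [|apply (conv_eta (Univ 0))]; apply conv_lam; auto
    | eapply conv_trans; [apply conv_sym, (conv_eta (Univ 0))|]; apply conv_lam; auto
    | apply internal_cst_dec_bl in e; subst; apply conv_refl ].
Qed.

(** Enough for the terms below; a lack of fuel can only make the checker fail. *)
Definition fuel := 500.

Definition univ_level (T : tm) : option nat :=
  match whnf fuel T [] with Univ i => Some i | _ => None end.

(** Cumulativity at the end of a telescope.  The judgment lets a type, but not a
    family of types, move to a larger universe; an abstraction [a] may still be
    given the larger type, by moving its body. *)
Fixpoint sub (a T A : tm) {struct A} : bool :=
  if tm_beq T A then true else
  match A with
  | Univ k => match univ_level T with Some i => i <=? k | None => false end
  | Pi D A' =>
      match a, T with
      | Lam D0 b, Pi D1 T' =>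
          if tm_beq D0 D then if tm_beq D1 D then sub b T' A' else false else false
      | _, _ => false
      end
  | _ => false
  end.

Fixpoint target_level (n : nat) (T : tm) : option nat :=
  match n with
  | 0 => None
  | S n => match whnf fuel T [] with
           | Univ i => Some i
           | Pi _ B => target_level n B
           | _ => None
           end
  end.

(** A guess at the levels [i] and [j] of a constant applied to arguments of types
    [Ts].  [F] is the type of the constant for [i = 0] and [j = 1], so that a
    parameter whose type ends in [Univ 0] bounds [i] and one whose type ends in
    [Univ 1] determines [j].  The guess needs no justification, since the
    constant has a type at all levels. *)
Fixpoint levels (F : tm) (Ts : list tm) : nat * nat :=
  match F, Ts with
  | Pi D F', T :: Ts' =>
      let (i, j) := levels F' Ts' in
      (* The parameters of the constants are families of at most two variables;
         the bound 9 on the length of telescopes is generous. *)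
      match target_level 9 D with
      | Some m =>
          match target_level 9 T with
          | Some k => if m =? 0 then (max k i, j) else (i, max k j)
          | None => (i, j)
          end
      | None => (i, j)
      end
  | _, _ => (0, 0)
  end.

Definition sort (inf : list tm -> tm -> option tm) (G : list tm) (A : tm) :
    option nat :=
  match inf G A with Some T => univ_level T | None => None end.

(** A conversion is used only after checking that its target is a type.  This
    repeats work, but makes soundness independent of the metatheory of the
    judgment (weakening, substitution, typing of types). *)
Definition check (inf : list tm -> tm -> option tm) (G : list tm) (a T A : tm) :
    bool :=
  if sub a T A then true else
  if eqv fuel T A then match sort inf G A with Some _ => true | None => false end
  else false.

Fixpoint infer_all (inf : tm -> option tm) (l : list tm) : option (list tm) :=
  match l with
  | [] => Some []
  | a :: l =>
      match inf a, infer_all inf l with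
      | Some T, Some Ts => Some (T :: Ts)
      | _, _ => None
      end
  end.

(** Reduction is not known to preserve typing, so a product type found by reducing
    is checked again. *)
Definition as_pi (inf : list tm -> tm -> option tm) (G : list tm) (F : tm) :
    option (tm * tm) :=
  match F with
  | Pi A B => Some (A, B)
  | _ =>
      match whnf fuel F [] with
      | Pi A B =>
          match sort inf G (Pi A B) with Some _ => Some (A, B) | None => None end
      | _ => None
      end
  end.

Fixpoint infer_apps (inf : list tm -> tm -> option tm) (G : list tm) (F : tm)
    (l Ts : list tm) : option tm :=
  match l, Ts with
  | [], [] => Some F
  | a :: l, T :: Ts =>
      match as_pi inf G F with
      | Some (A, B) =>
          if check inf G a T A then infer_apps inf G (subst a 0 B) l Ts else None
      | None => None
      end
  | _, _ => None
  end.

Fixpoint infer (n : nat) (G : list tm) (t : tm) : option tm :=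
  match n with
  | 0 => None
  | S n =>
      match t with
      | Var x =>
          match nth_error G x with
          | Some A => Some (Nat.iter (S x) (lift 0) A)
          | None => None
          end
      | Univ i => Some (Univ (S i))
      | Pi A B =>
          match sort (infer n) G A, sort (infer n) (A :: G) B with
          | Some i, Some j => Some (Univ (max i j))
          | _, _ => None
          end
      | Lam A b =>
          match sort (infer n) G A, infer n (A :: G) b with
          | Some _, Some B => Some (Pi A B)
          | _, _ => None
          end
      | Cst c => Some (ty 0 0 c)
      | App _ _ =>
          let (h, l) := spine t [] in
          match infer_all (infer n G) l with
          | Some Ts =>
              match
                match h with
                | Cst c => let (i, j) := levels (ty 0 1 c) Ts in Some (ty i j c)
                | _ => infer n G h
                end
              with
              | Some F => infer_apps (infer n) G F l Ts
              | None => None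
              end
          | None => None
          end
      end
  end.

Definition checks (n : nat) (G : list tm) (t A : tm) : bool :=
  match infer n G t with Some T => check (infer n) G t T A | None => false end.

Lemma has_cumul_le G A i j : i <= j -> has G A (Univ i) -> has G A (Univ j).
Proof. induction 1; auto using has_cumul. Qed.

Lemma spine_sound t :
  forall l, unwind (fst (spine t l)) (snd (spine t l)) = unwind t l.
Proof. induction t; intros l; cbn; auto. Qed.

Lemma univ_level_sound G t T i :
  univ_level T = Some i -> has G t T -> has G t (Univ i).
Proof.
  unfold univ_level; intros e h.
  destruct (whnf fuel T []) eqn:E; try discriminate; injection e as <-.
  eapply has_conv; [exact h | apply has_Univ |].
  rewrite <- E; apply (whnf_sound fuel T []).
Qed.

(** The invariant of inference.  It is stronger than [has G a T] because the type
    of an abstraction may have to be enlarged later, when the premises of its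
    typing are no longer available. *)
Definition sound (G : list tm) (a T : tm) : Prop :=
  forall A, sub a T A = true -> has G a A.

Lemma sound_has G a T : sound G a T -> has G a T.
Proof.
  intros h; apply h; destruct T; cbn [sub]; rewrite internal_tm_dec_lb; auto.
Qed.

Lemma sound_intro G a T :
  match a with Lam _ _ => False | _ => True end -> has G a T -> sound G a T.
Proof.
  intros ha h A e.
  assert (H : T = A \/ exists k i, A = Univ k /\ univ_level T = Some i /\ i <= k).
  { destruct A; cbn [sub] in e; destruct (tm_beq T _) eqn:e1;
      try (apply internal_tm_dec_bl in e1; auto); try discriminate.
    - right; destruct (univ_level T) as [k|] eqn:E; try discriminate.
      apply Nat.leb_le in e; eauto.
    - destruct a; contradiction || discriminate. }
  destruct H as [<-|(k & i & -> & E & le)]; auto.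
  eapply has_cumul_le, univ_level_sound; eauto.
Qed.

Lemma sound_lam G D b T i :
  has G D (Univ i) -> sound (D :: G) b T -> sound G (Lam D b) (Pi D T).
Proof.
  intros hD hb A e.
  assert (h : has G (Lam D b) (Pi D T)) by eauto using has_Lam, sound_has.
  destruct A; cbn [sub] in e; destruct (tm_beq (Pi D T) _) eqn:e1;
    try (apply internal_tm_dec_bl in e1; rewrite <- e1; exact h); try discriminate.
  destruct (tm_beq D A1) eqn:e2; try discriminate.
  apply internal_tm_dec_bl in e2 as <-.
  eapply has_Lam; eauto.
Qed.

Definition sound_infer (inf : list tm -> tm -> option tm) : Prop :=
  forall G a T, inf G a = Some T -> sound G a T.

Lemma sort_sound inf G A i :
  sound_infer inf -> sort inf G A = Some i -> has G A (Univ i).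
Proof.
  intros hinf; unfold sort; destruct (inf G A) as [T|] eqn:E; try discriminate.
  intros e; eapply univ_level_sound; eauto using sound_has.
Qed.

Lemma check_sound inf G a T A :
  sound_infer inf -> sound G a T -> check inf G a T A = true -> has G a A.
Proof.
  unfold check; intros hinf h e; destruct (sub a T A) eqn:e1; auto.
  destruct (eqv fuel T A) eqn:e2; try discriminate.
  destruct (sort inf G A) as [i|] eqn:E; try discriminate.
  eapply has_conv; eauto using sound_has, sort_sound, eqv_sound.
Qed.

Lemma as_pi_sound inf G f F A B :
  sound_infer inf -> as_pi inf G F = Some (A, B) -> has G f F -> has G f (Pi A B).
Proof.
  intros hinf e h.
  assert (H : F = Pi A B \/
    exists i, whnf fuel F [] = Pi A B /\ sort inf G (Pi A B) = Some i).
  { unfold as_pi in e; destruct F; try (injection e as -> ->; auto);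
      right; destruct (whnf fuel _ []) eqn:E; try discriminate;
      destruct (sort inf G _) eqn:E'; try discriminate;
      injection e as -> ->; eauto. }
  destruct H as [<-|(i & E & E')]; auto.
  eapply has_conv; [exact h | apply (sort_sound _ _ _ _ hinf E') |].
  rewrite <- E; apply (whnf_sound fuel F []).
Qed.

Lemma infer_apps_sound inf G : sound_infer inf -> forall l Ts f F T,
  infer_all (inf G) l = Some Ts -> has G f F ->
  infer_apps inf G F l Ts = Some T -> has G (unwind f l) T.
Proof.
  intros hinf; induction l as [|a l IH]; cbn; intros Ts f F T eT hf e.
  - injection eT as <-; injection e as <-; exact hf.
  - destruct (inf G a) as [Ta|] eqn:Ea; try discriminate.
    destruct (infer_all _ l) as [Ts'|]; try discriminate; injection eT as <-.
    destruct (as_pi inf G F) as [[A B]|] eqn:EF; try discriminate.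
    destruct (check inf G a Ta A) eqn:Ec; try discriminate.
    eapply IH; [reflexivity | | exact e].
    eapply has_App; eauto using as_pi_sound, check_sound.
Qed.

Lemma infer_sound n : sound_infer (infer n).
Proof.
  unfold sound_infer.
  induction n as [|n IH]; cbn [infer]; intros G a T e; try discriminate.
  destruct a as [x|i|A B|A b|f a|c].
  - destruct (nth_error G x) as [A|] eqn:E; try discriminate.
    injection e as <-; apply sound_intro; cbn; auto; apply (has_Var _ _ _ E).
  - injection e as <-; apply sound_intro; cbn; auto using has_Univ.
  - destruct (sort (infer n) G A) as [i|] eqn:EA; try discriminate.
    destruct (sort (infer n) _ B) as [j|] eqn:EB; try discriminate.
    injection e as <-; apply sound_intro; cbn; auto.
    apply has_Pi; (eapply has_cumul_le; [|eapply sort_sound; eauto]);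
      auto using Nat.le_max_l, Nat.le_max_r.
  - destruct (sort (infer n) G A) as [i|] eqn:EA; try discriminate.
    destruct (infer n _ b) as [B|] eqn:Eb; try discriminate.
    injection e as <-; eapply sound_lam; eauto using sort_sound.
  - apply sound_intro; cbn [sub]; auto.
    pose proof (spine_sound (App f a) []) as es.
    destruct (spine (App f a) []) as [h l]; cbn [fst snd] in es.
    destruct (infer_all _ l) as [Ts|] eqn:El; try discriminate.
    change (has G (unwind (App f a) []) T); rewrite <- es.
    assert (H : exists F, has G h F /\ infer_apps (infer n) G F l Ts = Some T).
    { destruct h;
        try (destruct (infer n G _) as [F|] eqn:EF; [|discriminate];
             exists F; eauto using sound_has).
      destruct (levels _ Ts) as [i j]; exists (ty i j c); auto using has_Cst. }
    destruct H as (F & hF & eF); eauto using infer_apps_sound.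
  - injection e as <-; apply sound_intro; cbn; auto using has_Cst.
Qed.

Lemma checks_sound n G t A : checks n G t A = true -> has G t A.
Proof.
  unfold checks; destruct (infer n G t) as [T|] eqn:E; try discriminate.
  apply check_sound; [apply infer_sound | exact (infer_sound n G t T E)].
Qed.

(** * Change of universe levels *)

Definition raise_cst (d : nat) (c : cst) : cst :=
  match c with Univalence i => Univalence (i + d) | _ => c end.

Fixpoint raise (d : nat) (t : tm) : tm :=
  match t with
  | Var x => Var x
  | Univ i => Univ (i + d)
  | Pi A B => Pi (raise d A) (raise d B)
  | Lam A b => Lam (raise d A) (raise d b)
  | App f a => App (raise d f) (raise d a)
  | Cst c => Cst (raise_cst d c)
  end.

Lemma raise_lift d t : forall k, raise d (lift k t) = lift k (raise d t).
Proof. induction t; intros k; cbn; f_equal; auto. Qed.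

Lemma raise_subst d t :
  forall u k, raise d (subst u k t) = subst (raise d u) k (raise d t).
Proof.
  induction t; intros u k; cbn; f_equal; auto.
  - destruct (x ?= k); auto.
  - rewrite IHt2, raise_lift; auto.
  - rewrite IHt2, raise_lift; auto.
Qed.

Lemma raise_conv d t u : conv t u -> conv (raise d t) (raise d u).
Proof.
  induction 1; cbn; rewrite ?raise_subst, ?raise_lift;
    first [apply conv_sym; assumption | eapply conv_trans; eassumption
          | solve [constructor; assumption] | constructor].
Qed.

(** The exceptional constants are the base types in [Univ 0]; by cumulativity they
    belong to the raised universe too. *)
Lemma raise_ty d i j c :
  raise d (ty i j c) = ty (i + d) (j + d) (raise_cst d c) \/
  exists k, ty i j c = Univ k /\ ty (i + d) (j + d) (raise_cst d c) = Univ k.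
Proof. destruct c; try (left; reflexivity); right; exists 0; auto. Qed.

Lemma raise_has d G t A :
  has G t A -> has (map (raise d) G) (raise d t) (raise d A).
Proof.
  induction 1 as [G x A e|G i|G A B i _ IHA _ IHB|G A b B i _ IHA _ IHb
    |G f a A B _ IHf _ IHa|G c i j|G A i _ IH|G t A B i _ IHt _ IHB e]; cbn [raise].
  - replace (raise d (Nat.iter (S x) (lift 0) A))
      with (Nat.iter (S x) (lift 0) (raise d A)).
    + apply has_Var; rewrite nth_error_map, e; reflexivity.
    + generalize (S x); intros n; induction n as [|n IH]; cbn; auto.
      rewrite raise_lift; f_equal; exact IH.
  - apply has_Univ.
  - apply has_Pi; auto.
  - eapply has_Lam; eauto.
  - rewrite raise_subst; eapply has_App; eauto.
  - destruct (raise_ty d i j c) as [->|(k & -> & e)]; [apply has_Cst|].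
    cbn; eapply has_cumul_le; [apply Nat.le_add_r|]; rewrite <- e; apply has_Cst.
  - apply has_cumul; auto.
  - eapply has_conv; eauto using raise_conv.
Qed.

(** * Lemmas as variables *)

Fixpoint closed_at (k : nat) (t : tm) : bool :=
  match t with
  | Var x => x <? k
  | Univ _ | Cst _ => true
  | Pi A B => closed_at k A && closed_at (S k) B
  | Lam A b => closed_at k A && closed_at (S k) b
  | App f a => closed_at k f && closed_at k a
  end.

Lemma subst_closed t : forall k u, closed_at k t = true -> subst u k t = t.
Proof.
  induction t; intros k u; cbn; rewrite ?Bool.andb_true_iff; intros e; f_equal;
    try (destruct e; auto; fail); auto.
  apply Nat.ltb_lt in e; rewrite (proj2 (Nat.compare_lt_iff x k) e); reflexivity.
Qed.

(** Only closed types are considered: as they do not mention the variables of [G],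
    substituting proofs for these leaves them unchanged. *)
Definition admissible (G : list tm) : Prop :=
  forall t A, closed_at 0 A = true -> has G t A -> exists u, has [] u A.

Lemma admissible_nil : admissible [].
Proof. intros t A _ h; exists t; exact h. Qed.

(** A beta-redex serves as the definition of a lemma [t : A]. *)
Lemma admissible_cons G A t :
  admissible G ->
  match sort (infer fuel) G A with
  | Some _ => checks fuel G t A
  | None => false
  end = true ->
  admissible (A :: G).
Proof.
  intros hG e u B hB hu.
  destruct (sort _ G A) as [i|] eqn:E; try discriminate.
  apply (hG (App (Lam A u) t) B hB).
  rewrite <- (subst_closed B 0 t hB).
  eapply has_App; [eapply has_Lam|];
    eauto using checks_sound, sort_sound, infer_sound.
Qed.

Local Open Scope form_scope.

(** [l] lists the types of lemmas, latest first.  A lemma may mention the earlier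
    ones, so its type is read at the depth at which it enters the context. *)
Fixpoint context (l : list form) : list tm :=
  match l with [] => [] | A :: l => A (length l) :: context l end.

(** The variable of a lemma: it is stored by its level, which is the number of
    lemmas proved before it. *)
Definition next (l : list form) : form := bound (length l).

Definition theory (l : list form) : Prop := admissible (context l).

Definition verify (l : list form) (A t : form) : bool :=
  match sort (infer fuel) (context l) (A (length l)) with
  | Some _ => checks fuel (context l) (t (length l)) (A (length l))
  | None => false
  end.

Lemma theory_nil : theory [].
Proof. apply admissible_nil. Qed.

Lemma theory_cons l A t : theory l -> verify l A t = true -> theory (A :: l).
Proof. unfold theory, verify; cbn [context]; apply admissible_cons. Qed.

Lemma theory_proves l A t :
  theory l -> closed_at 0 (closed A) = true ->
  checks fuel (context l) (t (length l)) (closed A) = true -> HoTT_proves A.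
Proof. intros h hA e; eapply h; eauto using checks_sound. Qed.

(** * Elementary constructions *)

Definition sigma_elim (A : form) (B P : form -> form)
    (f : form -> form -> form) (x : form) : form :=
  cc SigmaInd ⋅ A ⋅ (lam A B) ⋅ (lam (sg A B) P)
    ⋅ (λ a : A, λ b : B a, f a b) ⋅ x.
Definition pr2 (A : form) (B : form -> form) (x : form) : form :=
  sigma_elim A B (fun x => B (pr1 A B x)) (fun _ b => b) x.

Definition sectionOf (A B f : form) : form :=
  Σ g : B ⇒ A, Π y : B, idt B (f ⋅ (g ⋅ y)) y.
Definition retractionOf (A B f : form) : form :=
  Σ g : B ⇒ A, Π x : A, idt A (g ⋅ (f ⋅ x)) x.
Definition inverse (A B f e : form) : form :=
  pr1 (B ⇒ A) (fun g => Π y : B, idt B (f ⋅ (g ⋅ y)) y)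
    (pr1 (sectionOf A B f) (fun _ => retractionOf A B f) e).

Definition center (A h : form) : form := pr1 A (fun a => Π x : A, idt A a x) h.
Definition contraction (A h x : form) : form :=
  pr2 A (fun a => Π x : A, idt A a x) h ⋅ x.
Definition contr_path (A h x y : form) : form :=
  let c := center A h in
  cat A x c y (inv A c x (contraction A h x)) (contraction A h y).

Definition cat_inv_l (A x y p : form) : form :=
  ind A x (fun y p => idt (idt A y y) (cat A y x y (inv A x y p) p) (refl A y))
    (refl (idt A x x) (refl A x)) y p.
Definition tp_inv_r (A : form) (P : form -> form) (x y p u : form) : form :=
  ind A x
    (fun y p =>
       Π u : P y, idt (P y) (tp A P x y p (tp A P y x (inv A x y p) u)) u)
    (λ u : P x, refl (P x) u) y p ⋅ u.

Definition funext_type : form :=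
  Π A : univ 2, Π B : A ⇒ univ 2,
  Π f : (Π a : A, B ⋅ a), Π g : (Π a : A, B ⋅ a),
  (Π a : A, idt (B ⋅ a) (f ⋅ a) (g ⋅ a)) ⇒ idt (Π a : A, B ⋅ a) f g.
Definition funext_proof : form :=
  λ A : univ 2, λ B : A ⇒ univ 2,
  λ f : (Π a : A, B ⋅ a), λ g : (Π a : A, B ⋅ a),
  let F := Π a : A, B ⋅ a in
  let E g := Π a : A, idt (B ⋅ a) (f ⋅ a) (g ⋅ a) in
  λ h : E g,
  inverse (idt F f g) (E g)
    (λ p : idt F f g, ind F f (fun g _ => E g) (λ a : A, refl (B ⋅ a) (f ⋅ a)) g p)
    (cc FunExt ⋅ A ⋅ B ⋅ f ⋅ g) ⋅ h.
Definition funext : form := next [].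
Definition upto_funext := [funext_type].
Lemma theory_funext : theory upto_funext.
Proof.
  apply (theory_cons [] _ funext_proof theory_nil).
  vm_cast_no_check (eq_refl true).
Qed.

(** * Truncation levels *)

(** The proof uses families in the universes 0, 1 and 2.  One level is enough for
    the lemmas on truncation: when [m] is a numeral, the types [isTrunc l m A] for
    different [l] are judgmentally equal. *)
Definition T (m A : form) : form := isTrunc 2 m A.

Definition retract_at (m : form) : form :=
  Π X : univ 2, Π F : univ 2, Π s : X ⇒ F, Π r : F ⇒ X,
  (Π x : X, idt X (r ⋅ (s ⋅ x)) x) ⇒ T m F ⇒ T m X.
Definition retract_lam (m : form)
    (b : form -> form -> form -> form -> form -> form -> form) : form :=
  λ X : univ 2, λ F : univ 2, λ s : X ⇒ F, λ r : F ⇒ X,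
  λ e : (Π x : X, idt X (r ⋅ (s ⋅ x)) x), λ h : T m F, b X F s r e h.
Definition retract_proof : form :=
  λ m : nat_, nat_ind retract_at
    (retract_lam (num 0) (fun X F s r e h =>
       let c := center F h in
       mkpair X (fun c => Π x : X, idt X c x) (r ⋅ c)
         (λ x : X, cat X (r ⋅ c) (r ⋅ (s ⋅ x)) x
            (ap F X (app r) c (s ⋅ x) (contraction F h (s ⋅ x))) (e ⋅ x))))
    (fun m IH => retract_lam (succ m) (fun X F s r e h =>
       λ x : X, λ y : X,
       (* [x = y] is a retract of [s x = s y]: apply [r] and correct both ends by
          [e].  At the reflexivity path the two corrections cancel. *)
       let back y q :=
         cat X x (r ⋅ (s ⋅ y)) y
           (cat X x (r ⋅ (s ⋅ x)) (r ⋅ (s ⋅ y)) (inv X (r ⋅ (s ⋅ x)) x (e ⋅ x))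
              (ap F X (app r) (s ⋅ x) (s ⋅ y) q))
           (e ⋅ y) in
       IH ⋅ idt X x y ⋅ idt F (s ⋅ x) (s ⋅ y)
         ⋅ (λ p : idt X x y, ap X F (app s) x y p)
         ⋅ (λ q : idt F (s ⋅ x) (s ⋅ y), back y q)
         ⋅ (λ p : idt X x y, ind X x
              (fun y p => idt (idt X x y) (back y (ap X F (app s) x y p)) p)
              (cat_inv_l X (r ⋅ (s ⋅ x)) x (e ⋅ x)) y p)
         ⋅ (h ⋅ (s ⋅ x) ⋅ (s ⋅ y))))
    m.
Definition retract : form := next upto_funext.
Definition upto_retract := (Π m : nat_, retract_at m) :: upto_funext.
Lemma theory_retract : theory upto_retract.
Proof.
  apply (theory_cons _ _ retract_proof theory_funext).
  vm_cast_no_check (eq_refl true).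
Qed.

(** Any family with an element over [x] and a map to the paths from [x] bounds the
    truncation level of these paths.  The map need not be an inverse of transport
    of the element: composed with the inverse of its value at the element it
    becomes a left inverse, by path induction.  This is the way in which all
    identity types are bounded below. *)
Definition encode_type : form :=
  Π m : nat_, Π Y : univ 2, Π x : Y, Π F : Y ⇒ univ 2, Π s : F ⋅ x,
  Π r : (Π y : Y, F ⋅ y ⇒ idt Y x y), Π y : Y,
  T m (F ⋅ y) ⇒ T m (idt Y x y).
Definition encode_proof : form :=
  λ m : nat_, λ Y : univ 2, λ x : Y, λ F : Y ⇒ univ 2, λ s : F ⋅ x,
  λ r : (Π y : Y, F ⋅ y ⇒ idt Y x y), λ y : Y, λ h : T m (F ⋅ y),
  let dec y z := cat Y x x y (inv Y x x (r ⋅ x ⋅ s)) (r ⋅ y ⋅ z) in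
  let enc y p := tp Y (app F) x y p s in
  retract ⋅ m ⋅ idt Y x y ⋅ (F ⋅ y)
    ⋅ (λ p : idt Y x y, enc y p)
    ⋅ (λ z : F ⋅ y, dec y z)
    ⋅ (λ p : idt Y x y,
         ind Y x (fun y p => idt (idt Y x y) (dec y (enc y p)) p)
           (cat_inv_l Y x x (r ⋅ x ⋅ s)) y p)
    ⋅ h.
Definition encode : form := next upto_retract.
Definition upto_encode := encode_type :: upto_retract.
Lemma theory_encode : theory upto_encode.
Proof.
  apply (theory_cons _ _ encode_proof theory_retract).
  vm_cast_no_check (eq_refl true).
Qed.

(** Truncation levels are cumulative.  For a contractible [A] the paths are
    encoded by the constant family [A]. *)
Definition trunc_succ_at (m : form) : form :=
  Π A : univ 2, T m A ⇒ T (succ m) A.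
Definition trunc_succ_proof : form :=
  λ m : nat_, nat_ind trunc_succ_at
    (λ A : univ 2, λ h : T (num 0) A, λ x : A, λ y : A,
       encode ⋅ num 0 ⋅ A ⋅ x ⋅ (λ _ : A, A) ⋅ x
         ⋅ (λ y : A, λ _ : A, contr_path A h x y) ⋅ y ⋅ h)
    (fun m IH => λ A : univ 2, λ h : T (succ m) A, λ x : A, λ y : A,
       IH ⋅ idt A x y ⋅ (h ⋅ x ⋅ y))
    m.
Definition trunc_succ : form := next upto_encode.
Definition upto_trunc_succ := (Π m : nat_, trunc_succ_at m) :: upto_encode.
Lemma theory_trunc_succ : theory upto_trunc_succ.
Proof.
  apply (theory_cons _ _ trunc_succ_proof theory_encode).
  vm_cast_no_check (eq_refl true).
Qed.

Definition trunc_sigma_at (m : form) : form :=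
  Π A : univ 2, Π B : A ⇒ univ 2,
  T m A ⇒ (Π a : A, T m (B ⋅ a)) ⇒ T m (Σ a : A, B ⋅ a).
Definition trunc_sigma_lam (m : form)
    (b : form -> form -> form -> form -> form) : form :=
  λ A : univ 2, λ B : A ⇒ univ 2,
  λ h : T m A, λ k : (Π a : A, T m (B ⋅ a)), b A B h k.
Definition trunc_sigma_proof : form :=
  λ m : nat_, nat_ind trunc_sigma_at
    (trunc_sigma_lam (num 0) (fun A B h k =>
       let S := Σ a : A, B ⋅ a in
       let mk := mkpair A (app B) in
       let c := center A h in
       let d := center (B ⋅ c) (k ⋅ c) in
       mkpair S (fun z => Π x : S, idt S z x) (mk c d)
         (λ x : S, sigma_elim A (app B) (fun x => idt S (mk c d) x)
            (fun a b =>
               ind A c (fun a _ => Π b : B ⋅ a, idt S (mk c d) (mk a b))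
                 (λ b : B ⋅ c,
                    ap (B ⋅ c) S (mk c) d b (contraction (B ⋅ c) (k ⋅ c) b))
                 a (contraction A h a) ⋅ b) x)))
    (fun m IH => trunc_sigma_lam (succ m) (fun A B h k =>
       let S := Σ a : A, B ⋅ a in
       let mk := mkpair A (app B) in
       let fst := pr1 A (app B) in
       let snd := pr2 A (app B) in
       λ x : S, sigma_elim A (app B) (fun x => Π y : S, T m (idt S x y))
         (fun a b =>
            (* Paths from the pair of [a] and [b] are encoded by pairs of a path in
               [A] and a path over it. *)
            let over a' b' p := idt (B ⋅ a') (tp A (app B) a a' p b) b' in
            let E y := Σ p : idt A a (fst y), over (fst y) (snd y) p in
            λ y : S, encode ⋅ m ⋅ S ⋅ mk a b ⋅ (λ y : S, E y)
              ⋅ mkpair (idt A a a) (over a b) (refl A a) (refl (B ⋅ a) b)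
              ⋅ (λ y : S,
                   sigma_elim A (app B) (fun y => E y ⇒ idt S (mk a b) y)
                     (fun a' b' => λ e : (Σ p : idt A a a', over a' b' p),
                        sigma_elim (idt A a a') (over a' b')
                          (fun _ => idt S (mk a b) (mk a' b'))
                          (fun p q =>
                             ind A a
                               (fun a' p => Π b' : B ⋅ a',
                                  over a' b' p ⇒ idt S (mk a b) (mk a' b'))
                               (λ b' : B ⋅ a, λ q : idt (B ⋅ a) b b',
                                  ap (B ⋅ a) S (mk a) b b' q)
                               a' p ⋅ b' ⋅ q) e) y)
              ⋅ y
              ⋅ (IH ⋅ idt A a (fst y)
                   ⋅ (λ p : idt A a (fst y), over (fst y) (snd y) p)
                   ⋅ (h ⋅ a ⋅ fst y)
                   ⋅ (λ p : idt A a (fst y),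
                        k ⋅ fst y ⋅ tp A (app B) a (fst y) p b ⋅ snd y))) x))
    m.
Definition trunc_sigma : form := next upto_trunc_succ.
Definition upto_trunc_sigma := (Π m : nat_, trunc_sigma_at m) :: upto_trunc_succ.
Lemma theory_trunc_sigma : theory upto_trunc_sigma.
Proof.
  apply (theory_cons _ _ trunc_sigma_proof theory_trunc_succ).
  vm_cast_no_check (eq_refl true).
Qed.

Definition trunc_pi_at (m : form) : form :=
  Π A : univ 2, Π B : A ⇒ univ 2,
  (Π a : A, T m (B ⋅ a)) ⇒ T m (Π a : A, B ⋅ a).
Definition trunc_pi_proof : form :=
  λ m : nat_, nat_ind trunc_pi_at
    (λ A : univ 2, λ B : A ⇒ univ 2, λ h : (Π a : A, T (num 0) (B ⋅ a)),
       let F := Π a : A, B ⋅ a in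
       let c := λ a : A, center (B ⋅ a) (h ⋅ a) in
       mkpair F (fun c => Π f : F, idt F c f) c
         (λ f : F, funext ⋅ A ⋅ B ⋅ c ⋅ f
            ⋅ (λ a : A, contraction (B ⋅ a) (h ⋅ a) (f ⋅ a))))
    (fun m IH =>
       λ A : univ 2, λ B : A ⇒ univ 2, λ h : (Π a : A, T (succ m) (B ⋅ a)),
       let F := Π a : A, B ⋅ a in
       let E f g := Π a : A, idt (B ⋅ a) (f ⋅ a) (g ⋅ a) in
       λ f : F, λ g : F,
         encode ⋅ m ⋅ F ⋅ f ⋅ (λ g : F, E f g) ⋅ (λ a : A, refl (B ⋅ a) (f ⋅ a))
           ⋅ (λ g : F, λ e : E f g, funext ⋅ A ⋅ B ⋅ f ⋅ g ⋅ e) ⋅ g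
           ⋅ (IH ⋅ A ⋅ (λ a : A, idt (B ⋅ a) (f ⋅ a) (g ⋅ a))
                ⋅ (λ a : A, h ⋅ a ⋅ (f ⋅ a) ⋅ (g ⋅ a))))
    m.
Definition trunc_pi : form := next upto_trunc_sigma.
Definition upto_trunc_pi := (Π m : nat_, trunc_pi_at m) :: upto_trunc_sigma.
Lemma theory_trunc_pi : theory upto_trunc_pi.
Proof.
  apply (theory_cons _ _ trunc_pi_proof theory_trunc_sigma).
  vm_cast_no_check (eq_refl true).
Qed.

(** If [A] is contractible then so is [isContr A], as a sum of products of paths
    in [A]; the higher levels follow by function extensionality. *)
Definition trunc_unique_at (m : form) : form :=
  Π A : univ 2, Π a : T m A, Π b : T m A, idt (T m A) a b.
Definition trunc_unique_proof : form :=
  λ m : nat_, nat_ind trunc_unique_at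
    (λ A : univ 2, λ a : T (num 0) A, λ b : T (num 0) A,
       contr_path (isContr A)
         (trunc_sigma ⋅ num 0 ⋅ A ⋅ (λ c : A, Π x : A, idt A c x) ⋅ a
            ⋅ (λ c : A, trunc_pi ⋅ num 0 ⋅ A ⋅ (λ x : A, idt A c x)
                 ⋅ (λ x : A, trunc_succ ⋅ num 0 ⋅ A ⋅ a ⋅ c ⋅ x))) a b)
    (fun m IH => λ A : univ 2, λ a : T (succ m) A, λ b : T (succ m) A,
       funext ⋅ A ⋅ (λ x : A, Π y : A, T m (idt A x y)) ⋅ a ⋅ b
         ⋅ (λ x : A, funext ⋅ A ⋅ (λ y : A, T m (idt A x y)) ⋅ (a ⋅ x) ⋅ (b ⋅ x)
              ⋅ (λ y : A, IH ⋅ idt A x y ⋅ (a ⋅ x ⋅ y) ⋅ (b ⋅ x ⋅ y))))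
    m.
Definition trunc_unique : form := next upto_trunc_pi.
Definition upto_trunc_unique := (Π m : nat_, trunc_unique_at m) :: upto_trunc_pi.
Lemma theory_trunc_unique : theory upto_trunc_unique.
Proof.
  apply (theory_cons _ _ trunc_unique_proof theory_trunc_pi).
  vm_cast_no_check (eq_refl true).
Qed.

Definition trunc_equiv_type : form :=
  Π m : nat_, Π A : univ 2, Π B : univ 2, T m A ⇒ T m B ⇒ T m (equiv A B).
Definition trunc_equiv_proof : form :=
  λ m : nat_, λ A : univ 2, λ B : univ 2, λ hA : T m A, λ hB : T m B,
  let L f := sectionOf A B f in
  let R f := retractionOf A B f in
  let hBA := trunc_pi ⋅ m ⋅ B ⋅ (λ _ : B, A) ⋅ (λ _ : B, hA) in
  trunc_sigma ⋅ m ⋅ (A ⇒ B) ⋅ (λ f : A ⇒ B, isEquiv A B f)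
    ⋅ (trunc_pi ⋅ m ⋅ A ⋅ (λ _ : A, B) ⋅ (λ _ : A, hB))
    ⋅ (λ f : A ⇒ B, trunc_sigma ⋅ m ⋅ L f ⋅ (λ _ : L f, R f)
         ⋅ (trunc_sigma ⋅ m ⋅ (B ⇒ A)
              ⋅ (λ g : B ⇒ A, Π y : B, idt B (f ⋅ (g ⋅ y)) y) ⋅ hBA
              ⋅ (λ g : B ⇒ A, trunc_pi ⋅ m ⋅ B ⋅ (λ y : B, idt B (f ⋅ (g ⋅ y)) y)
                   ⋅ (λ y : B, trunc_succ ⋅ m ⋅ B ⋅ hB ⋅ (f ⋅ (g ⋅ y)) ⋅ y)))
         ⋅ (λ _ : L f, trunc_sigma ⋅ m ⋅ (B ⇒ A)
              ⋅ (λ g : B ⇒ A, Π x : A, idt A (g ⋅ (f ⋅ x)) x) ⋅ hBA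
              ⋅ (λ g : B ⇒ A, trunc_pi ⋅ m ⋅ A ⋅ (λ x : A, idt A (g ⋅ (f ⋅ x)) x)
                   ⋅ (λ x : A, trunc_succ ⋅ m ⋅ A ⋅ hA ⋅ (g ⋅ (f ⋅ x)) ⋅ x)))).
Definition trunc_equiv : form := next upto_trunc_unique.
Definition upto_trunc_equiv := trunc_equiv_type :: upto_trunc_unique.
Lemma theory_trunc_equiv : theory upto_trunc_equiv.
Proof.
  apply (theory_cons _ _ trunc_equiv_proof theory_trunc_unique).
  vm_cast_no_check (eq_refl true).
Qed.

(** Univalence makes the universe of (shifted) m-types an (m+1)-type: its paths
    are encoded by equivalences, a path between the underlying types being enough
    by [trunc_unique].  As univalence is an axiom about one universe, this is a
    scheme in [l]; two instances are needed. *)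
Definition hType (l m : nat) : form := Σ A : univ l, isTrunc l (num m) A.
Definition trunc_hType_type (l m : nat) : form := T (num (S m)) (hType l m).
Definition trunc_hType_proof (l m : nat) : form :=
  let U := hType l m in
  let El := pr1 (univ l) (isTrunc l (num m)) in
  let mk := mkpair (univ l) (isTrunc l (num m)) in
  λ x : U, sigma_elim (univ l) (isTrunc l (num m))
    (fun x => Π y : U, T (num m) (idt U x y))
    (fun A a => λ y : U,
       encode ⋅ num m ⋅ U ⋅ mk A a ⋅ (λ y : U, equiv A (El y)) ⋅ idEquiv A
         ⋅ (λ y : U, sigma_elim (univ l) (isTrunc l (num m))
              (fun y => equiv A (El y) ⇒ idt U (mk A a) y)
              (fun B b => λ e : equiv A B,
                 let ua := inverse (idt (univ l) A B) (equiv A B)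
                   (λ p : idt (univ l) A B,
                      ind (univ l) A (fun X _ => equiv A X) (idEquiv A) B p)
                   (cc (Univalence l) ⋅ A ⋅ B) in
                 ind (univ l) A
                   (fun B _ => Π b : isTrunc l (num m) B, idt U (mk A a) (mk B b))
                   (λ b : isTrunc l (num m) A,
                      ap (isTrunc l (num m) A) U (mk A) a b
                        (trunc_unique ⋅ num m ⋅ A ⋅ a ⋅ b))
                   B (ua ⋅ e) ⋅ b) y)
         ⋅ y
         ⋅ (trunc_equiv ⋅ num m ⋅ A ⋅ El y ⋅ a
              ⋅ pr2 (univ l) (isTrunc l (num m)) y)) x.
Definition trunc_hProp : form := next upto_trunc_equiv.
Definition upto_trunc_hProp := trunc_hType_type 0 1 :: upto_trunc_equiv.
Lemma theory_trunc_hProp : theory upto_trunc_hProp.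
Proof.
  apply (theory_cons _ _ (trunc_hType_proof 0 1) theory_trunc_equiv).
  vm_cast_no_check (eq_refl true).
Qed.

Definition trunc_hSet : form := next upto_trunc_hProp.
Definition upto_trunc_hSet := trunc_hType_type 1 2 :: upto_trunc_hProp.
Lemma theory_trunc_hSet : theory upto_trunc_hSet.
Proof.
  apply (theory_cons _ _ (trunc_hType_proof 1 2) theory_trunc_hProp).
  vm_cast_no_check (eq_refl true).
Qed.

(** * Connected types *)

(** The inclusion of [a] into [A] is (m-2)-connected, as an induction principle.
    Thus [m = 1], [m = 2], [m = 3] say that [A] is 0-, 1- and 2-connected.  The
    equation [f a = p] is a datum of the principle because the step to the loop
    space needs it. *)
Definition Conn (l : nat) (m A a : form) : form :=
  Π P : A ⇒ univ l, (Π x : A, isTrunc l m (P ⋅ x)) ⇒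
  Π p : P ⋅ a, Σ f : (Π x : A, P ⋅ x), idt (P ⋅ a) (f ⋅ a) p.
Definition conn_lam (l : nat) (m A a : form)
    (b : form -> form -> form -> form) : form :=
  λ P : A ⇒ univ l, λ h : (Π x : A, isTrunc l m (P ⋅ x)), λ p : P ⋅ a, b P h p.
Definition ext (A a P p f e : form) : form :=
  mkpair (Π x : A, P ⋅ x) (fun f => idt (P ⋅ a) (f ⋅ a) p) f e.
Definition ext_fun (A a P p z : form) : form :=
  pr1 (Π x : A, P ⋅ x) (fun f => idt (P ⋅ a) (f ⋅ a) p) z.
Definition ext_eq (A a P p z : form) : form :=
  pr2 (Π x : A, P ⋅ x) (fun f => idt (P ⋅ a) (f ⋅ a) p) z.

(** Transport [p] along the meridian of [a] to get a point over the south pole.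
    That the other meridians transport it to the same point is a family of path
    types over [A], one truncation level lower, with [refl] over [a]. *)
Definition conn_susp_type : form :=
  Π m : nat_, Π A : univ 2, Π a : A,
  Conn 2 m A a ⇒ Conn 2 (succ m) (susp A) (north A).
Definition conn_susp_proof : form :=
  λ m : nat_, λ A : univ 2, λ a : A, λ c : Conn 2 m A a,
  conn_lam 2 (succ m) (susp A) (north A) (fun P h p =>
    let trans x := tp (susp A) (app P) (north A) (south A) (merid A x) p in
    let Q := λ x : A, idt (P ⋅ south A) (trans x) (trans a) in
    let q := refl (P ⋅ south A) (trans a) in
    ext (susp A) (north A) P p
      (λ x : susp A, cc SuspInd ⋅ A ⋅ P ⋅ p ⋅ trans a
         ⋅ ext_fun A a Q q
             (c ⋅ Q ⋅ (λ x : A, h ⋅ south A ⋅ trans x ⋅ trans a) ⋅ q) ⋅ x)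
      (refl (P ⋅ north A) p)).
Definition conn_susp : form := next upto_trunc_hSet.
Definition upto_conn_susp := conn_susp_type :: upto_trunc_hSet.
Lemma theory_conn_susp : theory upto_conn_susp.
Proof.
  apply (theory_cons _ _ conn_susp_proof theory_trunc_hSet).
  vm_cast_no_check (eq_refl true).
Qed.

(** For a family of propositions the data over the loops of [K~(G,1)] and over
    the fillers exist automatically, by contractibility of the relevant path
    types. *)
Definition conn_em_type : form :=
  Π G : univ 0, Π z : G, Π p : G ⇒ G ⇒ G, Π k : nat_,
  Conn 2 (num 1) (Ktilde 0 (Grp G z p) k) (Ktilde_pt 0 (Grp G z p) k).
Definition conn_em_proof : form :=
  λ G : univ 0, λ z : G, λ p : G ⇒ G ⇒ G, λ k : nat_,
  let X k := Ktilde 0 (Grp G z p) k in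
  let x0 k := Ktilde_pt 0 (Grp G z p) k in
  nat_ind (fun k => Conn 2 (num 1) (X k) (x0 k))
    (conn_lam 2 (num 1) (kg1 G p) (kpt G p) (fun P h b =>
       let D q := kover G p (app P) b q in
       let hb := h ⋅ kpt G p in
       let over g := tp (kg1 G p) (app P) (kpt G p) (kpt G p) (kloop G p g) b in
       let l := λ g : G, center (D (kloop G p g)) (hb ⋅ over g ⋅ b) in
       ext (kg1 G p) (kpt G p) P b
         (λ x : kg1 G p, kind G p P b l
            (λ g : G, λ g' : G,
               let gg := p ⋅ g ⋅ g' in
               let u := ktpfill G p (app P) b g g'
                          (kcatOver G p (app P) b g g' (l ⋅ g) (l ⋅ g')) in
               center (idt (D (kloop G p gg)) u (l ⋅ gg))
                 (trunc_succ ⋅ num 1 ⋅ (P ⋅ kpt G p) ⋅ hb ⋅ over gg ⋅ b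
                    ⋅ u ⋅ (l ⋅ gg))) x)
         (refl (P ⋅ kpt G p) b)))
    (fun k IH => conn_lam 2 (num 1) (susp (X k)) (north (X k)) (fun P h q =>
       (* The suspension gains a level, which is given up again: families of
          propositions are families of sets. *)
       conn_susp ⋅ num 1 ⋅ X k ⋅ x0 k ⋅ IH ⋅ P
         ⋅ (λ x : susp (X k), trunc_succ ⋅ num 1 ⋅ (P ⋅ x) ⋅ (h ⋅ x)) ⋅ q))
    k.
Definition conn_em : form := next upto_conn_susp.
Definition upto_conn_em := conn_em_type :: upto_conn_susp.
Lemma theory_conn_em : theory upto_conn_em.
Proof.
  apply (theory_cons _ _ conn_em_proof theory_conn_susp).
  vm_cast_no_check (eq_refl true).
Qed.

(** The truncation in [K(G,3+k)] has shifted index [5+k]. *)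
Definition plus5 (k : form) : form := succ (succ (succ (succ (succ k)))).
Definition trunc_plus5_at (k : form) : form :=
  Π A : univ 2, T (num 3) A ⇒ T (plus5 k) A.
Definition trunc_plus5_proof : form :=
  λ k : nat_, nat_ind trunc_plus5_at
    (λ A : univ 2, λ h : T (num 3) A,
       trunc_succ ⋅ num 4 ⋅ A ⋅ (trunc_succ ⋅ num 3 ⋅ A ⋅ h))
    (fun k IH => λ A : univ 2, λ h : T (num 3) A,
       trunc_succ ⋅ plus5 k ⋅ A ⋅ (IH ⋅ A ⋅ h)) k.
Definition trunc_plus5 : form := next upto_conn_em.
Definition upto_trunc_plus5 := (Π k : nat_, trunc_plus5_at k) :: upto_conn_em.
Lemma theory_trunc_plus5 : theory upto_trunc_plus5.
Proof.
  apply (theory_cons _ _ trunc_plus5_proof theory_conn_em).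
  vm_cast_no_check (eq_refl true).
Qed.

(** Families of m-types are families of n-types, so sections over [Z] extend to
    the n-truncation. *)
Definition conn_trunc_type : form :=
  Π m : nat_, Π n : nat_, (Π A : univ 2, T m A ⇒ T n A) ⇒
  Π Z : univ 2, Π z : Z, Conn 2 m Z z ⇒ Conn 2 m (trunc n Z) (tr n Z z).
Definition conn_trunc_proof : form :=
  λ m : nat_, λ n : nat_, λ w : (Π A : univ 2, T m A ⇒ T n A),
  λ Z : univ 2, λ z : Z, λ c : Conn 2 m Z z,
  conn_lam 2 m (trunc n Z) (tr n Z z) (fun P h p =>
    let Q := λ x : Z, P ⋅ tr n Z x in
    let d := c ⋅ Q ⋅ (λ x : Z, h ⋅ tr n Z x) ⋅ p in
    ext (trunc n Z) (tr n Z z) P p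
      (λ x : trunc n Z, cc TruncInd ⋅ n ⋅ Z ⋅ P
         ⋅ (λ x : trunc n Z, w ⋅ (P ⋅ x) ⋅ (h ⋅ x)) ⋅ ext_fun Z z Q p d ⋅ x)
      (ext_eq Z z Q p d)).
Definition conn_trunc : form := next upto_trunc_plus5.
Definition upto_conn_trunc := conn_trunc_type :: upto_trunc_plus5.
Lemma theory_conn_trunc : theory upto_conn_trunc.
Proof.
  apply (theory_cons _ _ conn_trunc_proof theory_trunc_plus5).
  vm_cast_no_check (eq_refl true).
Qed.

(** A family [Q] over the loops is a point over [y0] of the family [C] below, whose
    members are (m+1)-types by the proof [t] of [trunc_hType_type].  Its
    section [g] is a family over all paths starting at [y0], which has a section by
    path induction; over the loops [g] agrees with [Q].  The universe of m-types
    lies one level higher, whence the drop from [S l] to [l]. *)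
Definition conn_loop_type (l m : nat) : form :=
  Π Y : univ 0, Π y0 : Y,
  Conn (S l) (num (S m)) Y y0 ⇒ Conn l (num m) (idt Y y0 y0) (refl Y y0).
Definition conn_loop_proof (l m : nat) (t : form) : form :=
  λ Y : univ 0, λ y0 : Y, λ c : Conn (S l) (num (S m)) Y y0,
  let O := idt Y y0 y0 in
  conn_lam l (num m) O (refl Y y0) (fun Q h q =>
    let U := hType l m in
    let El := pr1 (univ l) (isTrunc l (num m)) in
    let C := λ y : Y, idt Y y0 y ⇒ U in
    let Q' := λ p : O, mkpair (univ l) (isTrunc l (num m)) (Q ⋅ p) (h ⋅ p) in
    let d := c ⋅ C ⋅ (λ y : Y, trunc_pi ⋅ num (S m) ⋅ idt Y y0 y
                        ⋅ (λ _ : idt Y y0 y, U) ⋅ (λ _ : idt Y y0 y, t)) ⋅ Q' in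
    let g := ext_fun Y y0 C Q' d in
    let e := ext_eq Y y0 C Q' d in
    let fib p X := El (X ⋅ p) in
    let toQ p u := tp (O ⇒ U) (fib p) (g ⋅ y0) Q' e u in
    let base := tp (O ⇒ U) (fib (refl Y y0)) Q' (g ⋅ y0)
                  (inv (O ⇒ U) (g ⋅ y0) Q' e) q in
    ext O (refl Y y0) Q q
      (λ p : O, toQ p (ind Y y0 (fun y p => El (g ⋅ y ⋅ p)) base y0 p))
      (tp_inv_r (O ⇒ U) (fib (refl Y y0)) (g ⋅ y0) Q' e q)).
Definition conn_loop1 : form := next upto_conn_trunc.
Definition upto_conn_loop1 := conn_loop_type 1 2 :: upto_conn_trunc.
Lemma theory_conn_loop1 : theory upto_conn_loop1.
Proof.
  apply (theory_cons _ _ (conn_loop_proof 1 2 trunc_hSet) theory_conn_trunc).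
  vm_cast_no_check (eq_refl true).
Qed.

Definition conn_loop2 : form := next upto_conn_loop1.
Definition upto_conn_loop2 := conn_loop_type 0 1 :: upto_conn_loop1.
Lemma theory_conn_loop2 : theory upto_conn_loop2.
Proof.
  apply (theory_cons _ _ (conn_loop_proof 0 1 trunc_hProp) theory_conn_loop1).
  vm_cast_no_check (eq_refl true).
Qed.

(** * Maps from the projective plane *)

(** For a proposition [Q], the type [R X] of functions from [X ⇒ Q] to [Q] is an
    existence statement for [X], as far as proofs of [Q] are concerned.  [point],
    [path] and [path2] are such statements for the paths from [y0] to [y], for the
    paths between two of these, and for the paths between two of the latter; path
    induction reduces each to a family over [Y], its loops or its double loops,
    with [refl] over the base point.  In the induction principle of RP2 the data
    over [ℓ] and [sq] are paths of just these kinds. *)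
Definition rp2_section_type : form :=
  Π Y : univ 0, Π y0 : Y, Conn 2 (num 3) Y y0 ⇒
  Π Q : univ 0, T (num 1) Q ⇒ Π f : rp2 ⇒ Y,
  ((Π x : rp2, idt Y y0 (f ⋅ x)) ⇒ Q) ⇒ Q.
Definition rp2_section_proof : form :=
  λ Y : univ 0, λ y0 : Y, λ c : Conn 2 (num 3) Y y0,
  λ Q : univ 0, λ hQ : T (num 1) Q, λ f : rp2 ⇒ Y,
  λ k : (Π x : rp2, idt Y y0 (f ⋅ x)) ⇒ Q,
  let L y := idt Y y0 y in
  let O := L y0 in
  let r := refl Y y0 in
  let O2 := idt O r r in
  let r2 := refl O r in
  let c1 := conn_loop1 ⋅ Y ⋅ y0 ⋅ c in
  let c2 := conn_loop2 ⋅ O ⋅ r ⋅ c1 in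
  let R X := (X ⇒ Q) ⇒ Q in
  let hR X := trunc_pi ⋅ num 1 ⋅ (X ⇒ Q) ⋅ (λ _ : X ⇒ Q, Q) ⋅ (λ _ : X ⇒ Q, hQ) in
  let ret X x := λ g : X ⇒ Q, g ⋅ x in
  let point y :=
    let P := λ y : Y, R (L y) in
    ext_fun Y y0 P (ret O r)
      (c ⋅ P
         ⋅ (λ y : Y,
              trunc_succ ⋅ num 2 ⋅ (P ⋅ y)
                ⋅ (trunc_succ ⋅ num 1 ⋅ (P ⋅ y) ⋅ hR (L y)))
         ⋅ ret O r) ⋅ y in
  let path y u v :=
    let P := λ v : O, R (idt O r v) in
    ind Y y0 (fun y u => Π v : L y, R (idt (L y) u v))
      (ext_fun O r P (ret O2 r2)
         (c1 ⋅ P ⋅ (λ v : O, trunc_succ ⋅ num 1 ⋅ (P ⋅ v) ⋅ hR (idt O r v))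
            ⋅ ret O2 r2))
      y u ⋅ v in
  let path2 y u v s t :=
    let P := λ t : O2, R (idt O2 r2 t) in
    let r3 := refl O2 r2 in
    ind (L y) u (fun v s => Π t : idt (L y) u v, R (idt (idt (L y) u v) s t))
      (ind Y y0
         (fun y u =>
            Π t : idt (L y) u u, R (idt (idt (L y) u u) (refl (L y) u) t))
         (ext_fun O2 r2 P (ret (idt O2 r2 r2) r3)
            (c2 ⋅ P ⋅ (λ t : O2, hR (idt O2 r2 t)) ⋅ ret (idt O2 r2 r2) r3))
         y u)
      v s ⋅ t in
  let P := λ x : rp2, L (f ⋅ x) in
  let y := f ⋅ rp2pt in
  let over b := tp rp2 (app P) rp2pt rp2pt rp2ell b in
  let sqOver b l :=
    rp2tpsq (app P) b (invOver rp2 (app P) rp2pt rp2pt rp2ell b b l) in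
  point y ⋅ (λ b : L y,
    path y (over b) b ⋅ (λ l : rp2over (app P) b rp2ell,
      path2 y (over b) b (sqOver b l) l ⋅ (λ s : rp2sqOver (app P) b l,
        k ⋅ (λ x : rp2, rp2ind P b l s x)))).
Definition rp2_section : form := next upto_conn_loop2.
Definition upto_rp2_section := rp2_section_type :: upto_conn_loop2.
Lemma theory_rp2_section : theory upto_rp2_section.
Proof.
  apply (theory_cons _ _ rp2_section_proof theory_conn_loop2).
  vm_cast_no_check (eq_refl true).
Qed.

(** Equality with the constant map in a set truncation is a proposition, so that
    [rp2_section] applies to it. *)
Definition rp2_maps_type : form :=
  Π Y : univ 0, Π y0 : Y,
  Conn 2 (num 3) Y y0 ⇒ isContr (trunc (num 2) (rp2 ⇒ Y)).
Definition rp2_maps_proof : form :=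
  λ Y : univ 0, λ y0 : Y, λ c : Conn 2 (num 3) Y y0,
  let M := rp2 ⇒ Y in
  let M2 := trunc (num 2) M in
  let k := λ _ : rp2, y0 in
  let c0 := tr (num 2) M k in
  let h := cc Tr_trunc ⋅ num 2 ⋅ M in
  mkpair M2 (fun c => Π x : M2, idt M2 c x) c0
    (λ x : M2, cc TruncInd ⋅ num 2 ⋅ M ⋅ (λ x : M2, idt M2 c0 x)
       ⋅ (λ x : M2, trunc_succ ⋅ num 1 ⋅ idt M2 c0 x ⋅ (h ⋅ c0 ⋅ x))
       ⋅ (λ f : M,
            rp2_section ⋅ Y ⋅ y0 ⋅ c ⋅ idt M2 c0 (tr (num 2) M f)
              ⋅ (h ⋅ c0 ⋅ tr (num 2) M f) ⋅ f
              ⋅ (λ e : (Π x : rp2, idt Y y0 (f ⋅ x)),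
                   ap M M2 (tr (num 2) M) k f
                     (funext ⋅ rp2 ⋅ (λ _ : rp2, Y) ⋅ k ⋅ f ⋅ e)))
       ⋅ x).
Definition rp2_maps : form := next upto_rp2_section.
Definition upto_rp2_maps := rp2_maps_type :: upto_rp2_section.
Lemma theory_rp2_maps : theory upto_rp2_maps.
Proof.
  apply (theory_cons _ _ rp2_maps_proof theory_rp2_section).
  vm_cast_no_check (eq_refl true).
Qed.

(** With [n = 3+k], the space [K(G,n)] is the truncation of a double suspension of
    [Ktilde] at [k]: two suspensions lead from 0- to 2-connectedness. *)
Definition cohomology_type : form :=
  Π A : univ 0, Π z : A, Π p : A ⇒ A ⇒ A, Π n : nat_, nat_lt (num 2) n ⇒
  isContr (H 0 rp2 (Grp A z p) n).
Definition cohomology_proof : form :=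
  λ A : univ 0, λ z : A, λ p : A ⇒ A ⇒ A, λ n : nat_, λ lt : nat_lt (num 2) n,
  let G := Grp A z p in
  sigma_elim nat_ (fun k => idt nat_ (nat_add (num 2) (succ k)) n)
    (fun _ => isContr (H 0 rp2 G n))
    (fun k e =>
       let X := Ktilde 0 G k in
       let m := succ (succ (succ k)) in
       ind nat_ m (fun n _ => isContr (H 0 rp2 G n))
         (rp2_maps ⋅ K 0 G m ⋅ K_pt 0 G m
            ⋅ (conn_trunc ⋅ num 3 ⋅ plus5 k ⋅ (trunc_plus5 ⋅ k)
                 ⋅ susp (susp X) ⋅ north (susp X)
                 ⋅ (conn_susp ⋅ num 2 ⋅ susp X ⋅ north X
                      ⋅ (conn_susp ⋅ num 1 ⋅ X ⋅ Ktilde_pt 0 G k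
                           ⋅ (conn_em ⋅ A ⋅ z ⋅ p ⋅ k)))))
         n e)
    lt.
Definition cohomology : form := next upto_rp2_maps.
Definition upto_cohomology := cohomology_type :: upto_rp2_maps.
Lemma theory_cohomology : theory upto_cohomology.
Proof.
  apply (theory_cons _ _ cohomology_proof theory_rp2_maps).
  vm_cast_no_check (eq_refl true).
Qed.

Definition iso_contr_type : form :=
  Π X : univ 0, isContr X ⇒ Π p : X ⇒ X ⇒ X, isoTrivial X p.
Definition iso_contr_proof : form :=
  λ X : univ 0, λ c : isContr X, λ p : X ⇒ X ⇒ X,
  let I := cc Unit in
  let f := λ _ : X, cc TT in
  let back := λ _ : I, center X c in
  let mul f := Π x : X, Π y : X, idt I (f ⋅ (p ⋅ x ⋅ y))
                 ((λ _ : I, λ _ : I, cc TT) ⋅ (f ⋅ x) ⋅ (f ⋅ y)) in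
  mkpair (X ⇒ I) (fun f => isEquiv X I f × mul f) f
    (mkpair (isEquiv X I f) (fun _ => mul f)
       (mkpair (sectionOf X I f) (fun _ => retractionOf X I f)
          (mkpair (I ⇒ X) (fun g => Π y : I, idt I (f ⋅ (g ⋅ y)) y) back
             (λ y : I, cc UnitInd ⋅ (λ y : I, idt I (cc TT) y)
                ⋅ refl I (cc TT) ⋅ y))
          (mkpair (I ⇒ X) (fun g => Π x : X, idt X (g ⋅ (f ⋅ x)) x) back
             (λ x : X, contraction X c x)))
       (λ x : X, λ y : X, refl I (cc TT))).
Definition iso_contr : form := next upto_cohomology.
Definition upto_iso_contr := iso_contr_type :: upto_cohomology.
Lemma theory_iso_contr : theory upto_iso_contr.
Proof.
  apply (theory_cons _ _ iso_contr_proof theory_cohomology).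
  vm_cast_no_check (eq_refl true).
Qed.

Definition vanishing_type (i : nat) : form :=
  forall_AbGrp i (fun G =>
    Π n : nat_, nat_lt (num 2) n ⇒
    isContr (H i rp2 G n) ×
    (Π add : KAddition i G n, isoTrivial (H i rp2 G n) (Hplus i rp2 G n add))).
Definition vanishing_proof : form :=
  λ A : univ 0, λ _ : isSet A, λ z : A, λ p : A ⇒ A ⇒ A, λ neg : A ⇒ A,
  λ _ : abLaws A z p neg, λ n : nat_, λ lt : nat_lt (num 2) n,
  let G := Grp A z p in
  let X := H 0 rp2 G n in
  let c := cohomology ⋅ A ⋅ z ⋅ p ⋅ n ⋅ lt in
  mkpair (isContr X)
    (fun _ => Π add : KAddition 0 G n, isoTrivial X (Hplus 0 rp2 G n add))
    c
    (λ add : KAddition 0 G n, iso_contr ⋅ X ⋅ c ⋅ Hplus 0 rp2 G n add).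

Lemma vanishing : HoTT_proves (vanishing_type 0).
Proof.
  apply (theory_proves upto_iso_contr _ vanishing_proof theory_iso_contr);
    vm_cast_no_check (eq_refl true).
Qed.

Theorem proposition57 (i : nat) :
  HoTT_proves
    (forall_AbGrp i (fun G =>
       Π n : nat_, nat_lt (num 2) n ⇒
       isContr (H i rp2 G n) ×
       (Π add : KAddition i G n,
          isoTrivial (H i rp2 G n) (Hplus i rp2 G n add)))).
Proof.
  destruct vanishing as [t h]; exists (raise i t).
  (* Raising by [i] turns the levels 0 of the statement into [0 + i], that is,
     [i]; so the two statements are convertible. *)
  exact (raise_has i [] _ _ h).
Qed.
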